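(* Let $f:M\to M$ be a diffeomorphism of a closed $d$-dimensional manifold $M$, let $\Lambda\subset M$ be a compact $f$-invariant set, let $k\ge2$ and let $n_1,\dots,n_k\geq 1$ be integers with $n_1+\cdots+n_k=d$. Then $f$ admits an $(n_1,\dots,n_k)$-dominated splitting over $\Lambda$ if and only if there exist supplementary $Df$-invariant projectors $P_1,\dots,P_k$ on $T_\Lambda M$ with $\dim(P_i)=n_i$ and constants $K>1$ and $\alpha>0$ such that for $i=1,\dots,k-1$, $$\|Df^{n+m}(x)P_i(x)Df^{-n}(f^n(x))\|\;\|Df^n(x)P_{i+1}(x)Df^{-(n+m)}(f^{n+m}(x))\|\le Ke^{-m\alpha}$$ for all $m,n\in\mathbb Z$ with $m\ge1$ and all $x\in\Lambda$.
   Context: The tangent bundle of $M$ carries a continuous inner product, with induced norm $\|\cdot\|$ (also used for operator norms). For $n\in\mathbb Z$, $Df^n(x):T_xM\to T_{f^n(x)}M$ is the derivative of $f^n$ at $x$, so $Df^{-n}(f^n(x)):T_{f^n(x)}M\to T_xM$ is its inverse. $T_\Lambda M$ is the restriction of $TM$ to $\Lambda$. A projector $P$ on $T_\Lambda M$ is a continuous fiber-preserving map which on each fiber $T_xM$ is a linear projection $P(x)$ ($P(x)^2=P(x)$). It is $Df$-invariant if $Df(x)P(x)=P(f(x))Df(x)$ for all $x\in\Lambda$. $\dim(P)=n$ means that $P(x)$ has rank $n$ for every $x\in\Lambda$. Projectors $P_1,\dots,P_k$ are supplementary if $P_1(x)+\cdots+P_k(x)=I$ and $P_i(x)P_j(x)=0$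 for $i\neq j$, for all $x\in\Lambda$. Dominated splitting: a $Df$-invariant splitting $T_xM=E_1(x)\oplus\cdots\oplus E_k(x)$, $x\in\Lambda$ (i.e. $Df(x)E_i(x)=E_i(f(x))$), is dominated if there are constants $C>1$, $\alpha>0$ such that for every $i<j$, every $x\in\Lambda$, every $u,v\in T_xM$ and all $m,n\in\mathbb Z$ with $m\ge0$, $$\frac{\|Df^{n+m}(x)P_i(x)u\|\,\|Df^n(x)P_j(x)v\|}{\|Df^n(x)P_i(x)u\|\,\|Df^{n+m}(x)P_j(x)v\|}\le Ce^{-m\alpha},$$ whenever the denominator does not vanish, where $P_i(x)$ is the oblique projection of $T_xM$ onto $E_i(x)$ along $\bigoplus_{j\neq i}E_j(x)$. $f$ admits an $(n_1,\dots,n_k)$-dominated splitting over $\Lambda$ if there is such a dominated splitting with $\dim E_i(x)=n_i$ for all $x\in\Lambda$ and all $i$. *)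

(* Defs.v *)
From HB Require Import structures.
From mathcomp Require Import all_boot all_order all_algebra.
From mathcomp Require Import all_classical all_reals all_analysis.

Set Implicit Arguments.
Unset Strict Implicit.
Unset Printing Implicit Defensive.

Import Order.TTheory GRing.Theory Num.Theory.
Import numFieldNormedType.Exports.

Local Open Scope classical_set_scope.
Local Open Scope ring_scope.

(* For an open set U.  In finite dimension, continuity of the derivative in
   operator norm is continuity of its value at each fixed vector. *)
Definition C1_on (R : realType) (d : nat) (U : set 'rV[R]_d)
    (h : 'rV[R]_d -> 'rV[R]_d) : Prop :=
  forall a, U a -> differentiable h a /\
    forall v : 'rV[R]_d, {for a, continuous (fun b => 'd h b v)}.

(* Closed (compact, without boundary, not necessarily connected)
   d-dimensional manifolds.  The atlas is indexed by the points of the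
   manifold: [chart p] is a chart around p, defined on the open set
   [chart_dom p], and [chart_inv p] is its inverse.  Their values outside
   [chart_dom p] and [chart p @` chart_dom p], respectively, are irrelevant.
   Class C^1 is the least regularity for which there is a tangent bundle;
   second countability follows from compactness. *)
Record closed_manifold (R : realType) (d : nat) := ClosedManifold {
  carrier :> topologicalType ;
  chart_dom : carrier -> set carrier ;
  chart : carrier -> carrier -> 'rV[R]_d ;
  chart_inv : carrier -> 'rV[R]_d -> carrier ;
  manifold_hausdorff : hausdorff_space carrier ;
  manifold_compact : compact [set: carrier] ;
  chart_dom_open : forall p, open (chart_dom p) ;
  chart_dom_center : forall p, chart_dom p p ;
  chart_image_open : forall p, open (chart p @` chart_dom p) ;
  chartK : forall p x, chart_dom p x -> chart_inv p (chart p x) = x ;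
  chart_continuous : forall p x, chart_dom p x ->
    {for x, continuous (chart p)} ;
  chart_inv_continuous : forall p x, chart_dom p x ->
    {for chart p x, continuous (chart_inv p)} ;
  chart_transition : forall p q,
    C1_on (chart p @` (chart_dom p `&` chart_dom q)) (chart q \o chart_inv p)
}.

Section TangentBundle.
Variables (R : realType) (d : nat) (M : closed_manifold R d).

(* The tangent space T_xM is identified with R^d by means of the chart
   [chart x] around x: a vector of T_xM is the element of 'rV[R]_d
   that represents it in the chart [chart x]. *)

(* Change of coordinates at x from the chart p to the chart q, i.e. the map
   sending the representative in p of a tangent vector at x to its
   representative in q.  In particular, on [chart_dom p], the maps
   [coord_change x p x] : T_xM -> R^d are the local trivialization of TM given
   by the chart p, and [coord_change p x x] : R^d -> T_xM is its inverse. *)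
Definition coord_change (p q x : M) : 'End('rV[R]_d) :=
  linfun ('d (chart q \o chart_inv p) (chart p x)).

(* The derivative DF(x) : T_xM -> T_{F(x)}M. *)
Definition tangent_map (F : M -> M) (x : M) : 'End('rV[R]_d) :=
  linfun ('d (chart (F x) \o F \o chart_inv x) (chart x x)).

Definition C1_map (F : M -> M) : Prop :=
  continuous F /\
  forall p q : M, C1_on (chart p @` (chart_dom p `&` F @^-1` chart_dom q))
                        (chart q \o F \o chart_inv p).

Record diffeomorphism := Diffeomorphism {
  diffeo_fun :> M -> M ;
  diffeo_inv : M -> M ;
  diffeo_funK : cancel diffeo_fun diffeo_inv ;
  diffeo_invK : cancel diffeo_inv diffeo_fun ;
  diffeo_fun_C1 : C1_map diffeo_fun ;
  diffeo_inv_C1 : C1_map diffeo_inv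
}.

Definition iterz (f : diffeomorphism) (n : int) : M -> M :=
  match n with
  | Posz k => iter k f
  | Negz k => iter k.+1 (diffeo_inv f)
  end.

(* Df^n(x) : T_xM -> T_{f^n(x)}M. *)
Definition Dn (f : diffeomorphism) (n : int) (x : M) : 'End('rV[R]_d) :=
  tangent_map (iterz f n) x.

(* Continuity on TM is continuity in local trivializations. *)
Record continuous_inner_product := ContinuousInnerProduct {
  ip :> M -> 'rV[R]_d -> 'rV[R]_d -> R ;
  ip_sym : forall x u v, ip x u v = ip x v u ;
  ip_linear : forall x a u v w, ip x (a *: u + v) w = a * ip x u w + ip x v w ;
  ip_gt0 : forall x u, u != 0 -> 0 < ip x u u ;
  ip_continuous : forall p : M,
    {within (chart_dom p `*` [set: 'rV[R]_d * 'rV[R]_d]), continuous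
      (fun z : M * ('rV[R]_d * 'rV[R]_d) =>
         ip z.1 (coord_change p z.1 z.1 z.2.1) (coord_change p z.1 z.1 z.2.2))}
}.

Definition tnorm (g : continuous_inner_product) (x : M) (v : 'rV[R]_d) : R :=
  Num.sqrt (g x v v).

(* Operator norm of a linear map T_xM -> T_yM. *)
Definition opnorm (g : continuous_inner_product) (x y : M)
    (A : 'End('rV[R]_d)) : R :=
  sup [set tnorm g y (A v) | v in [set v | tnorm g x v <= 1]].

(* Continuity, as a map T_LM -> T_LM, of the fiber-preserving map which is the
   linear map P x on each fiber T_xM, x in L. *)
Definition bundle_continuous (L : set M) (P : M -> 'End('rV[R]_d)) : Prop :=
  forall p : M,
    {within ((L `&` chart_dom p) `*` [set: 'rV[R]_d]), continuous
      (fun z : M * 'rV[R]_d =>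
         coord_change z.1 p z.1 (P z.1 (coord_change p z.1 z.1 z.2)))}.

Definition projector (L : set M) (P : M -> 'End('rV[R]_d)) : Prop :=
  bundle_continuous L P /\ forall x, L x -> (P x \o P x)%VF = P x.

Definition projector_dim (L : set M) (P : M -> 'End('rV[R]_d)) (n : nat) :
    Prop :=
  forall x, L x -> \dim (limg (P x)) = n.

Definition projector_invariant (f : diffeomorphism) (L : set M)
    (P : M -> 'End('rV[R]_d)) : Prop :=
  forall x, L x ->
    (tangent_map f x \o P x)%VF = (P (f x) \o tangent_map f x)%VF.

Definition supplementary (k : nat) (L : set M)
    (P : 'I_k -> M -> 'End('rV[R]_d)) : Prop :=
  forall x, L x ->
    \sum_i P i x = \1%VF /\ forall i j, i != j -> (P i x \o P j x)%VF = 0.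

(* T_xM is the direct sum of the E_i(x), x in L, and Df(x)E_i(x) = E_i(f(x)). *)
Definition invariant_splitting (f : diffeomorphism) (L : set M) (k : nat)
    (E : 'I_k -> M -> {vspace 'rV[R]_d}) : Prop :=
  forall x, L x ->
    [/\ directv (\sum_i E i x)%VS, (\sum_i E i x)%VS = fullv &
        forall i, (tangent_map f x @: E i x)%VS = E i (f x)].

(* Projection onto E_i(x) along the sum of the E_j(x), j != i. *)
Definition oblique_proj (k : nat) (E : 'I_k -> M -> {vspace 'rV[R]_d})
    (i : 'I_k) (x : M) : 'End('rV[R]_d) :=
  daddv_pi (E i x) (\sum_(j | j != i) E j x)%VS.

Definition dominated (g : continuous_inner_product) (f : diffeomorphism)
    (L : set M) (k : nat) (E : 'I_k -> M -> {vspace 'rV[R]_d}) : Prop :=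
  exists C alpha : R, [/\ 1 < C, 0 < alpha &
    forall (i j : 'I_k), (i < j)%N -> forall x, L x ->
    forall (u v : 'rV[R]_d) (m n : int), 0 <= m ->
      let num : R :=
        tnorm g (iterz f (n + m) x) (Dn f (n + m) x (oblique_proj E i x u)) *
        tnorm g (iterz f n x) (Dn f n x (oblique_proj E j x v)) in
      let den : R :=
        tnorm g (iterz f n x) (Dn f n x (oblique_proj E i x u)) *
        tnorm g (iterz f (n + m) x) (Dn f (n + m) x (oblique_proj E j x v)) in
      den != 0 -> num / den <= C * expR (- (m%:~R * alpha))].

Definition admits_dominated_splitting (g : continuous_inner_product)
    (f : diffeomorphism) (L : set M) (k : nat) (dims : 'I_k -> nat) : Prop :=
  exists E : 'I_k -> M -> {vspace 'rV[R]_d},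
    [/\ invariant_splitting f L E,
        forall i x, L x -> \dim (E i x) = dims i &
        dominated g f L E].

End TangentBundle.

(* Main.v *)
(* From projectors to a splitting: the inequality for P_i, P_{i+1} bounds the
   ratios of consecutive bundles, and intermediate nonzero vectors carry the
   bound to all i < j.

   From a splitting to projectors: domination over a long time m separates E_i
   from the sum of the previous bundles, because Df^m is bounded above and below
   over L; by induction the oblique projections are uniformly bounded.  For
   continuity, let T be a limit, along an ultrafilter y -> x, of the projections
   Q(y) onto E_1 + ... + E_s.  Boundedness, domination and the trace are closed
   conditions, so T and Q(x) satisfy the same ones, and these determine the
   projection: if two candidates of equal rank had different ranges, then a
   vector u of the first outside the second and a vector w of the second outside
   the first would each be negligible with respect to the other under Df^n as
   n -> +oo; time reversal gives the kernels. *)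

Require Import Defs.
From HB Require Import structures.
From mathcomp Require Import all_boot all_order all_algebra.
From mathcomp Require Import all_classical all_reals all_analysis.
From mathcomp Require Import ring lra.

Set Implicit Arguments.
Unset Strict Implicit.
Unset Printing Implicit Defensive.

Import Order.TTheory GRing.Theory Num.Theory.
Import numFieldNormedType.Exports.

Local Open Scope classical_set_scope.
Local Open Scope ring_scope.

(** * Linear algebra and filters *)

(** Nothing in the definition of a dominated splitting makes the bundles continuous: continuity of
    the projectors has to be extracted from domination itself. The argument works with the cumulated
    projections because they leave only two bundles, a slow one and a fast one: forward time then
    pins down the range and backward time the kernel, whereas a middle bundle is extremal in neither
    direction. Each P_i is recovered as the difference of two consecutive cumulated projections. The
    rank is not given by a closed condition, but the trace is continuous and equals the rank on
    idempotents; this is how dimensions survive the limit. The identification of T_xM with R^d by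
    the chart around x has no continuity in x. Limits are therefore taken in one fixed chart p:
    projections become matrices acting on rows, and the norm of Df^n becomes a function of a point y
    near x and of a coordinate vector u, jointly continuous in both. *)

Lemma mxtrace_idempotent (F : fieldType) d (A : 'M[F]_d) :
  A *m A = A -> \tr A = (\rank A)%:R.
Proof.
(* In a rank factorization A = C R, idempotence reads C R C R = C R; cancelling C on the left and R
   on the right leaves R C = 1, of size the rank, and C R and R C have the same trace. *)
move=> AA; have RC : row_base A *m col_base A = 1%:M.
  apply: (row_free_inj (row_base_free A)); rewrite mul1mx.
  apply: (row_full_inj (col_base_full A)).
  by rewrite -mulmxA mulmx_base mulmxA mulmx_base.
by rewrite -[in LHS](mulmx_base A) mxtrace_mulC RC mxtrace1.
Qed.

(** The rank is computed from a matrix B whose rows form a basis of the image: B is row free and has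
    the same row space as the matrix of f. *)
Lemma mxrank_lin1_mx (F : fieldType) d (f : 'End('rV[F]_d)) :
  \rank (lin1_mx f) = \dim (limg f).
Proof.
set A := lin1_mx f; have fE u : u *m A = f u by rewrite mul_rV_lin1.
pose B := \matrix_(i < \dim (limg f)) (vbasis (limg f))`_i.
have BE u : u *m B = \sum_i u 0 i *: (vbasis (limg f))`_i.
  by rewrite mulmx_sum_row; apply: eq_bigr => i _; rewrite rowK.
have Bfree : row_free B.
  apply: inj_row_free => u; rewrite BE => u0.
  apply/rowP => i; rewrite mxE.
  by have /freeP := basis_free (vbasisP (limg f)); apply.
suff AB : (A == B)%MS by rewrite (eqmx_rank AB); exact/eqP.
apply/andP; split; apply/row_subP => i.
  rewrite rowE fE (coord_vbasis (memv_img f (memvf _))).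
  apply/submxP; exists (\row_j coord (vbasis (limg f)) j (f 'e_i)).
  by rewrite BE; apply: eq_bigr => j _; rewrite mxE.
have /memv_imgP[w _] : row i B \in limg f.
  by rewrite rowK vbasis_mem// mem_nth// size_tuple.
by rewrite -fE => ->; exact: submxMl.
Qed.

Lemma lin1_mx_comp (F : fieldType) d (f g : 'End('rV[F]_d)) :
  lin1_mx (f \o g)%VF = lin1_mx g *m lin1_mx f.
Proof.
by apply/row_matrixP => i; rewrite row_mul !rowE !mul_rV_lin1 /= comp_lfunE.
Qed.

(** If N0 u > 2 N0 (u + v), then N0 v is at least half of N0 u and the last hypothesis gives N1 v >=
    2 N1 u. Since N1 v <= K N0 (u + v) + N1 u, this bounds N1 u, hence N0 u. In the application N0
    and N1 are the norms before and after Df^m. *)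
Lemma norm_bounded_of_angle (R : realFieldType) (V : zmodType) (N0 N1 : V -> R)
    (K K' : R) (u v : V) :
  (forall w, 0 <= N0 w) -> (forall w, 0 <= N1 w) ->
  (forall w w', N0 (w + w') <= N0 w + N0 w') ->
  (forall w w', N1 (w + w') <= N1 w + N1 w') ->
  (forall w, N0 (- w) = N0 w) -> (forall w, N1 (- w) = N1 w) ->
  (forall w, N1 w <= K * N0 w) -> (forall w, N0 w <= K' * N1 w) ->
  0 <= K -> 0 <= K' ->
  4 * (N1 u * N0 v) <= N0 u * N1 v ->
  N0 u <= (2 + K * K') * N0 (u + v).
Proof.
move=> N00 N10 N0D N1D N0N N1N NK NK' K0 K'0 uv.
set e := N0 (u + v).
have e0 : 0 <= e by exact: N00.
have h1 : N0 u <= e + N0 v by rewrite -{1}(addrK v u) -(N0N v); exact: N0D.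
have h2 : N1 v <= K * e + N1 u.
  rewrite -{1}(addrK u v) -(N1N u) (addrC v u).
  by apply: le_trans (N1D _ _) _; rewrite lerD2r NK.
have [h|h] := leP (N0 u) (2 * e).
  apply: le_trans h _; rewrite ler_wpM2r// lerDl; exact: mulr_ge0.
have u0 : 0 < N0 u by lra.
have h3 : N1 u <= K * e.
  have h4 : 2 * (N1 u * N0 u) <= 4 * (N1 u * N0 v).
    by have := N10 u; nra.
  have h5 : N0 u * N1 v <= N0 u * (K * e + N1 u) by rewrite ler_pM2l.
  rewrite -(ler_pM2l u0); nra.
apply: le_trans (NK' u) _; rewrite mulrDl.
have : K' * N1 u <= K' * (K * e) by rewrite ler_wpM2l.
by lra.
Qed.

(* Take u in the range of P' with u (1 - P) != 0 and w in the range of P with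
   w (1 - P') != 0: each of N n u and N n w would be negligible with respect
   to the other. *)
Lemma dominated_range_sub (R : realType) d (N : nat -> 'rV[R]_d -> R)
    (q : nat -> R) (B : R) (P P' : 'M[R]_d) :
  (forall n u, u != 0 -> 0 < N n u) ->
  q @ \oo --> 0 -> 0 <= B ->
  P *m P = P -> P' *m P' = P' -> \tr P = \tr P' ->
  (forall n u, N n (u *m (1%:M - P)) <= B * N n u) ->
  (forall n u, N n (u *m (1%:M - P')) <= B * N n u) ->
  (forall n, 0 <= q n) ->
  (forall n u v, N n (u *m P) * N 0 (v *m (1%:M - P)) <=
     q n * (N 0 (u *m P) * N n (v *m (1%:M - P)))) ->
  (forall n u v, N n (u *m P') * N 0 (v *m (1%:M - P')) <=
     q n * (N 0 (u *m P') * N n (v *m (1%:M - P')))) ->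
  P' *m P = P'.
Proof.
move=> N0 q0 B0 PP PP' trPP' bP bP' qge0 dP dP'.
apply: contrapT => /eqP nP'P.
have rkE : \rank P = \rank P'.
  by apply/eqP; rewrite -(eqr_nat R) -!mxtrace_idempotent// trPP'.
have idsub (Q Q' : 'M[R]_d) : Q *m Q = Q -> (Q' <= Q)%MS = (Q' *m Q == Q').
  move=> QQ; apply/idP/eqP => [/submxP[D ->]|<-]; last exact: submxMl.
  by rewrite -mulmxA QQ.
(* Equal ranks turn the failure of one inclusion of ranges into the failure of the other. *)
have nPP' : P *m P' != P.
  rewrite -idsub//; apply/negP => sPP'; move: nP'P; rewrite -idsub//.
  by rewrite -(mxrank_leqif_sup sPP') rkE eqxx.
have nz (Q Q' : 'M[R]_d) : Q' *m Q' = Q' -> Q' *m Q != Q' ->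
    exists2 u, u *m Q' = u & u *m (1%:M - Q) != 0 :> 'rV_d.
  move=> QQ' nQ; have : ~~ [forall i, row i (Q' *m (1%:M - Q)) == 0].
    apply: contra nQ => /forallP h; rewrite eq_sym -subr_eq0.
    rewrite -{1}(mulmx1 Q') -mulmxBr; apply/eqP/row_matrixP => i.
    by rewrite (eqP (h i)) row0.
  rewrite negb_forall => /existsP[i]; rewrite row_mul => ?.
  by exists (row i Q') => //; rewrite -row_mul QQ'.
have [u uP' uP] := nz _ _ PP' nP'P.
have [w wP wP'] := nz _ _ PP nPP'.
have u0 : u != 0 by apply: contra uP => /eqP ->; rewrite mul0mx.
have w0 : w != 0 by apply: contra wP' => /eqP ->; rewrite mul0mx.
pose c := N 0 (u *m (1%:M - P)) * N 0 (w *m (1%:M - P')).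
pose D := B ^+ 2 * (N 0 u * N 0 w).
have c0 : 0 < c by apply: mulr_gt0; exact: N0.
(* The two dominations are multiplied: N n u * N n w occurs on both sides and cancels, so the fixed
   positive c is bounded by a sequence tending to 0. *)
have key n : c <= q n * q n * D.
  have nu := N0 n _ u0; have nw := N0 n _ w0.
  have h1 : N n w * N 0 (u *m (1%:M - P)) <= q n * (N 0 w * (B * N n u)).
    apply: le_trans (_ : _ <= q n * (N 0 w * N n (u *m (1%:M - P)))) _.
      by have := dP n w u; rewrite wP.
    by apply: ler_wpM2l => //; apply: ler_wpM2l => //; exact/ltW/N0.
  have h2 : N n u * N 0 (w *m (1%:M - P')) <= q n * (N 0 u * (B * N n w)).
    apply: le_trans (_ : _ <= q n * (N 0 u * N n (w *m (1%:M - P')))) _.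
      by have := dP' n u w; rewrite uP'.
    by apply: ler_wpM2l => //; apply: ler_wpM2l => //; exact/ltW/N0.
  have nuw : 0 < N n u * N n w by exact: mulr_gt0.
  rewrite -(ler_pM2l nuw).
  have := ler_pM _ _ h1 h2; rewrite !mulr_ge0 ?(ltW (N0 _ _ _))//.
  move=> /(_ isT isT); rewrite /c /D => h; nra.
have : q n * q n * D @[n --> \oo] --> 0 * 0 * D.
  by apply: cvgMl; exact: cvgM.
rewrite !mul0r => /cvgr_to_ge h; have : c <= 0 by apply: h; exact: nearW.
by rewrite leNgt c0.
Qed.

(** For matrices acting on rows, the first equation is the inclusion of the range of P' in that of
    P, and the second is the same inclusion for the kernels. *)
Lemma idempotent_eq (F : fieldType) d (P P' : 'M[F]_d) :
  P' *m P = P' -> (1%:M - P') *m (1%:M - P) = 1%:M - P' -> P = P'.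
Proof.
rewrite mulmxBr mulmx1 mulmxBl mul1mx => -> /eqP.
by rewrite -subr_eq0 addrC addKr oppr_eq0 subr_eq0 => /eqP.
Qed.

(* N n is the norm of the image under Df^n: these closed conditions determine
   the projector onto the slow bundle along the fast one. *)
Definition splits (R : realType) d (B : R) (r : nat -> R) (tau : R)
    (N : int -> 'rV[R]_d -> R) (A : 'M[R]_d) : Prop :=
  [/\ A *m A = A, \tr A = tau,
      forall (n : int) u, N n (u *m A) <= B * N n u,
      forall (n : int) u, N n (u *m (1%:M - A)) <= B * N n u &
      forall (n : int) (m : nat) u v,
        N (n + m) (u *m A) * N n (v *m (1%:M - A)) <=
        r m * (N n (u *m A) * N (n + m) (v *m (1%:M - A)))].

Lemma splits_unique (R : realType) d (B : R) (r : nat -> R) (tau : R)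
    (N : int -> 'rV[R]_d -> R) (A A' : 'M[R]_d) :
  (forall n u, u != 0 -> 0 < N n u) -> 0 <= B -> (forall n, 0 <= r n) ->
    r @ \oo --> 0 ->
  splits B r tau N A -> splits B r tau N A' -> A = A'.
Proof.
move=> N0 B0 r0 rcvg [AA trA bA bA1 dA] [AA' trA' bA' bA1' dA'].
have one (C : 'M[R]_d) : 1%:M - (1%:M - C) = C by rewrite opprB addrC subrK.
have sub1 (C : 'M[R]_d) : C *m C = C -> (1%:M - C) *m (1%:M - C) = 1%:M - C.
  by move=> CC; rewrite mulmxBl mul1mx mulmxBr mulmx1 CC subrr subr0.
apply: idempotent_eq.
  apply: (@dominated_range_sub _ _ (fun n : nat => N n) r B) => //.
  - by move=> n; exact: N0.
  - by rewrite trA.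
  - by move=> n u v; have := dA 0 n u v; rewrite add0r.
  - by move=> n u v; have := dA' 0 n u v; rewrite add0r.
(* In backward time the complement 1 - A is the dominated side: the condition from time -n to time
   0, with its factors exchanged, is the domination required. *)
apply: (@dominated_range_sub _ _ (fun n : nat => N (- n%:Z)) r B) => //.
- by move=> n; exact: N0.
- exact: sub1.
- exact: sub1.
- by rewrite !raddfB /= trA trA'.
- by move=> n u; rewrite one.
- by move=> n u; rewrite one.
- move=> n u v; rewrite !one mulrC; have := dA (- n%:Z) n v u; rewrite addNr.
  by rewrite [X in _ <= _ * X]mulrC.
- move=> n u v; rewrite !one mulrC; have := dA' (- n%:Z) n v u; rewrite addNr.
  by rewrite [X in _ <= _ * X]mulrC.
Qed.


Lemma mulmx_cvg (R : realType) (T : Type) (G : set_system T) (a b c : nat)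
  (A : T -> 'M[R]_(a, b)) 
    (C : T -> 'M[R]_(b, c)) (A0 : 'M[R]_(a, b)) (C0 : 'M[R]_(b, c)) :
  Filter G -> (forall i j, A t i j @[t --> G] --> A0 i j) ->
  (forall i j, C t i j @[t --> G] --> C0 i j) ->
  forall i j, (A t *m C t) i j @[t --> G] --> (A0 *m C0) i j.
Proof.
move=> FG cA cC i j; rewrite mxE; under eq_cvg do rewrite mxE.
by apply: cvg_big => [|l _]; [exact: add_continuous|apply: cvgM].
Qed.

Lemma mx_cvg (R : realType) (T : Type) (G : set_system T) (a b : nat) 
    (A : T -> 'M[R]_(a, b)) (A0 : 'M[R]_(a, b)) :
  Filter G -> (forall i j, A t i j @[t --> G] --> A0 i j) -> A @ G --> A0.
Proof.
move=> FG cA; rewrite [A0]matrix_sum_delta.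
under eq_cvg do rewrite [A _]matrix_sum_delta.
apply: cvg_big => [|i _]; first exact: add_continuous.
apply: cvg_big => [|j _]; first exact: add_continuous.
by apply: cvgZ; [exact: cA|exact: cvg_cst].
Qed.


(** If the preimage of a neighbourhood V of l is not in F, then F together with the complement of
    this preimage generates a proper filter, and an ultrafilter finer than it cannot send h to l. *)
Lemma cvg_ultra (T : Type) (U : topologicalType) (F : set_system T) (h : T ->
  U) (l : U) :
  ProperFilter F ->
  (forall G : set_system T, UltraFilter G -> F `<=` G -> h @ G --> l) ->
  h @ F --> l.
Proof.
move=> FF hG V lV; apply: contrapT => nFV.
have FW : ProperFilter (within (~` (h @^-1` V)) F).
  apply: Build_ProperFilter_ex => W; rewrite /within => FW.
  apply: contrapT => nW; apply: nFV.
  have FW' : F [set t | (~` (h @^-1` V)) t -> W t] := FW.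
  apply: (filterS _ FW' : F (h @^-1` V)) => t ht.
  by apply: contrapT => nt; apply: nW; exists t; exact: ht.
have [G [GU FG]] := ultraFilterLemma FW.
have h1 : G (h @^-1` V).
  apply: (hG G GU) => // W FW'; apply: FG.
  by rewrite /within; apply: filterS FW' => t Wt _.
have h2 : G (~` (h @^-1` V)) by apply: FG; exact: withinT.
have GP : ProperFilter G by exact: ultra_proper.
by have [t []] := filter_ex (filterI h1 h2).
Qed.

(** Compactness of [-c, c] gives a cluster point, and a cluster point of an ultrafilter is a
    limit. *)
Lemma ultra_bounded_cvg (R : realType) (T : Type) (G : set_system T) (h : T ->
  R) c :
  UltraFilter G -> (\forall t \near G, `|h t| <= c) ->
    exists l : R, h @ G --> l.
Proof.
move=> GU hc; have GP : ProperFilter G by exact: ultra_proper.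
have /(_ (h @ G) _)[|l [_ cl]] := @segment_compact R (- c) c.
  by apply: filterS hc => t; rewrite ler_norml /= in_itv.
exists l => V lV; have [//|GV] := in_ultra_setVsetC (h @^-1` V) GU.
by have [t []] := cl (~` V) V GV lV.
Qed.

Lemma subr_mx_cvg (R : realType) (T : Type) (G : set_system T) (a b : nat)
    (A C : T -> 'M[R]_(a, b)) (A0 C0 : 'M[R]_(a, b)) :
  Filter G -> (forall i j, A t i j @[t --> G] --> A0 i j) ->
  (forall i j, C t i j @[t --> G] --> C0 i j) ->
  forall i j, (A t - C t) i j @[t --> G] --> (A0 - C0) i j.
Proof.
move=> FG cA cC i j; rewrite !mxE; under eq_cvg do rewrite !mxE.
by apply: cvgB; [exact: cA|exact: cC].
Qed.

(** * Calculus in charts *)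

(** The case to which locality of the derivative reduces: changing a map away from x adds to it a
    map that vanishes near x. *)
Lemma is_diff_near0 (R : realType) (V W : normedModType R) (h : V -> W) x :
  (\forall y \near x, h y = 0) -> is_diff x h 0.
Proof.
move=> hx; have hx0 : h x = 0 := nbhs_singleton hx.
have hs : \forall y \near (0 : V), h (y + x) = 0.
  rewrite (near_shift x); apply: filterS hx => z.
  by rewrite /= sub0r subrK.
have cont0 : continuous (0 : V -> W) by exact: cst_continuous.
have oh : h \o shift x = cst (h x) + (\0 : {linear V -> W}) +o_ 0 id.
  apply/eqaddoP => _/posnumP[e]; near=> y; rewrite /= hx0.
  rewrite !fctE /= addr0 subr0.
  have -> : h (y + x) = 0 by near: y.
  by rewrite normr0 mulr_ge0.
have dE := diff_unique (df := \0) cont0 oh.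
have df : differentiable h x.
  by apply/diff_locallyP; rewrite dE; split; [exact: cont0 | exact: oh].
exact: DiffDef df dE.
Unshelve. all: by end_near. Qed.

Lemma near_eq_is_diff (R : realType) (V W : normedModType R) (f g : V -> W) x :
  {near x, f =1 g} -> differentiable f x -> is_diff x g ('d f x).
Proof.
move=> fg df; have h0 : \forall y \near x, (g - f) y = 0.
  by apply: filterS fg => y fgy; rewrite !fctE fgy subrr.
have dh := is_diff_near0 h0.
have -> : g = f + (g - f) by apply/funext => y; rewrite !fctE addrC subrK.
have := @is_diffD _ _ _ f (g - f) ('d f x) 0 x (differentiableP df) dh.
by rewrite addr0.
Qed.

Section ChartCalculus.
Variables (R : realType) (d : nat) (M : closed_manifold R d).
Implicit Types (F G : M -> M) (p q r x : M).

(** Common generalization of [tangent_map F x], which is [locrep F x (F x) x], and of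
    [coord_change p q x], which is [locrep id p q x]. One chain rule thus serves for derivatives,
    changes of coordinates and mixtures of both. *)
Definition locrep F p q x : 'End('rV[R]_d) :=
  linfun ('d (chart q \o F \o chart_inv p) (chart p x)).

Lemma locrepE F p q x u :
  locrep F p q x u = 'd (chart q \o F \o chart_inv p) (chart p x) u.
Proof. by rewrite /locrep lfunE. Qed.

(** Class C^1 with the derivative continuous in the point of M rather than in its coordinates, a
    form that combines directly with other functions on M. *)
Definition smooth F : Prop := continuous F /\
  forall p q x, chart_dom p x -> chart_dom q (F x) ->
    differentiable (chart q \o F \o chart_inv p) (chart p x) /\
    forall v, {for x, continuous (fun y => locrep F p q y v)}.

Lemma nbhs_chart_dom p x : chart_dom p x -> \forall y \near x, chart_dom p y.
Proof. by move=> px; apply: open_nbhs_nbhs; split => //;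
  exact: chart_dom_open. Qed.

Lemma near_chart_inv p x (A : set M) : chart_dom p x -> nbhs x A ->
  \forall a \near chart p x, A (chart_inv p a) /\ chart p (chart_inv p a) = a.
Proof.
move=> px xA; near=> a; split.
  by near: a; apply: (chart_inv_continuous px); rewrite chartK.
suff : (chart p @` chart_dom p) a by move=> [y py <-]; rewrite chartK.
near: a; apply: open_nbhs_nbhs; split; first exact: chart_image_open.
by exists x.
Unshelve. all: by end_near. Qed.

Lemma C1_map_smooth F : C1_map F -> smooth F.
Proof.
move=> [cF dF]; split; first exact: cF.
move=> p q x px qFx.
have im y : chart_dom p y -> chart_dom q (F y) ->
    (chart p @` (chart_dom p `&` F @^-1` chart_dom q)) (chart p y).
  by move=> py qy; exists y.
have [df cdf] := dF p q _ (im x px qFx); split; first exact: df.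
move=> v.
have -> : (fun y => locrep F p q y v) =
    (fun b => 'd (chart q \o F \o chart_inv p) b v) \o chart p.
  by apply/funext => y; rewrite locrepE.
apply: continuous_comp; [exact: chart_continuous | exact: cdf].
Qed.

Lemma smooth_id : smooth id.
Proof.
apply: C1_map_smooth; split; first by move=> ?; exact: cvg_id.
by move=> p q; exact: chart_transition.
Qed.

Lemma locrep_comp_diff F G p q r x : smooth F -> smooth G ->
  chart_dom p x -> chart_dom q (F x) -> chart_dom r (G (F x)) ->
  is_diff (chart p x) (chart r \o (G \o F) \o chart_inv p)
    ('d (chart r \o G \o chart_inv q) (chart q (F x)) \o
     'd (chart q \o F \o chart_inv p) (chart p x)).
Proof.
move=> [cF sF] [cG sG] px qFx rGFx.
have [dF _] := sF p q x px qFx; have [dG _] := sG q r _ qFx rGFx.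
set f := chart q \o F \o chart_inv p; set g := chart r \o G \o chart_inv q.
have fx : f (chart p x) = chart q (F x) by rewrite /f /= chartK.
have dg : differentiable g (f (chart p x)) by rewrite fx.
rewrite -/f -/g -fx -(diff_comp dF dg).
(* The composite of the two local representatives agrees with the representative of the composite
   only near x, as long as F y stays in the domain of q. *)
apply: near_eq_is_diff; last exact: differentiable_comp.
have nq : \forall y \near x, chart_dom q (F y).
  exact: (cF x _ (nbhs_chart_dom qFx)).
apply: filterS (near_chart_inv px nq) => a [qa _].
by rewrite /g /f /= chartK.
Qed.

Lemma locrep_comp F G p q r x : smooth F -> smooth G ->
  chart_dom p x -> chart_dom q (F x) -> chart_dom r (G (F x)) ->
  locrep (G \o F) p r x = (locrep G q r (F x) \o locrep F p q x)%VF.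
Proof.
move=> sF sG px qFx rGFx; apply/lfunP => u.
have [_ /(congr1 (fun h => h u)) H] := locrep_comp_diff sF sG px qFx rGFx.
apply: (etrans (locrepE _ _ _ _ _)); apply: (etrans H); apply: esym.
apply: (etrans (comp_lfunE _ _ _)); apply: (etrans (locrepE _ _ _ _ _)).
exact: (congr1 _ (locrepE _ _ _ _ _)).
Qed.

(** In finite dimension continuity at each fixed vector suffices: u t is expanded in the canonical
    basis. *)
Lemma continuous_rV_apply (T : topologicalType) (t0 : T) (f : T ->
  'End('rV[R]_d))
    (u : T -> 'rV[R]_d) :
  (forall v, {for t0, continuous (fun t => f t v)}) ->
  {for t0, continuous u} -> {for t0, continuous (fun t => f t (u t))}.
Proof.
move=> cf cu.
have -> : (fun t => f t (u t)) = (fun t => \sum_j u t 0 j *: f t 'e_j).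
  apply/funext => t; rewrite {1}[u t]row_sum_delta linear_sum.
  by apply: eq_bigr => j _; rewrite linearZ.
apply: cvg_big => [|j _]; first exact: add_continuous.
apply: cvgZ; last exact: cf.
exact: (cvg_comp _ _ cu (@coord_continuous _ _ _ 0 j (u t0))).
Qed.

Lemma smooth_comp F G : smooth F -> smooth G -> smooth (G \o F).
Proof.
move=> sF sG; split.
  move=> x; apply: continuous_comp; [exact: sF.1|exact: sG.1].
(* The intermediate chart is the one around F x; it stays fixed while y varies near x. *)
move=> p r x px rGFx; have qFx := chart_dom_center (F x).
have dGF := locrep_comp_diff sF sG px qFx rGFx.
split; first by case: dGF.
move=> v.
have [_ cF] := sF.2 _ _ _ px qFx; have [_ cG] := sG.2 _ _ _ qFx rGFx.
have near_eq : \forall y \near x, locrep G (F x) r (F y)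
  (locrep F p (F x) y v) =
    locrep (G \o F) p r y v.
  near=> y; rewrite (@locrep_comp F G p (F x) r y)// ?comp_lfunE//; near: y.
  - exact: nbhs_chart_dom.
  - exact: (sF.1 x _ (nbhs_chart_dom qFx)).
  - exact: (sF.1 x _ (sG.1 (F x) _ (nbhs_chart_dom rGFx))).
apply: (cvg_trans (near_eq_cvg near_eq)).
have E : locrep G (F x) r (F x)
  (locrep F p (F x) x v) = locrep (G \o F) p r x v :=
  nbhs_singleton near_eq.
apply: (@eq_ind _ _ (fun l => (fun y => locrep G (F x) r (F y)
  (locrep F p (F x) y v))
  @ x --> l) _ _ E).
apply: (@continuous_rV_apply _ _ (fun y => locrep G (F x) r (F y)));
  last exact: cF.
move=> w; apply: (@continuous_comp _ _ _ F (fun y => locrep G (F x) r y w)).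
  exact: sF.1.
exact: cG.
Unshelve. all: by end_near. Qed.

End ChartCalculus.

(** * Iterates of the diffeomorphism and their derivatives *)

Section Iterates.
Variables (R : realType) (d : nat) (M : closed_manifold R d).
Variables (f : diffeomorphism M).
Implicit Types (n m : int) (p q x y : M).

Lemma iterzS n x : iterz f (n + 1) x = f (iterz f n x).
Proof.
case: n => [k|[|k]]; first by rewrite -PoszD addn1.
  by rewrite /= diffeo_invK.
rewrite (_ : Negz k.+1 + 1 = Negz k); first by rewrite /= diffeo_invK.
by rewrite !NegzE -addn1 PoszD opprD addrNK.
Qed.

Lemma iterzD n m x : iterz f (n + m) x = iterz f m (iterz f n x).
Proof.
elim/int_ind: m => [|m IH|m IH]; first by rewrite addr0.
  by rewrite -addn1 PoszD addrA !iterzS IH.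
apply: (can_inj (diffeo_funK f)); rewrite -!iterzS.
by rewrite -addn1 PoszD opprD addrA !subrK.
Qed.

Lemma iterzK n x : iterz f (- n) (iterz f n x) = x.
Proof. by rewrite -iterzD subrr. Qed.

Lemma smooth_iterz n : smooth (iterz f n).
Proof.
have si (h : M -> M) k : smooth h -> smooth (iter k h).
  by move=> sh; elim: k => [|k IH];
    [exact: smooth_id | exact: (smooth_comp IH sh)].
by case: n => n; apply: si; apply: C1_map_smooth;
  [exact: diffeo_fun_C1|exact: diffeo_inv_C1].
Qed.

Lemma iterz_mem (L : set M) n x : f @` L = L -> L x -> L (iterz f n x).
Proof.
move=> fL; elim/int_ind: n => // n IH Lx;
  first by rewrite -addn1 PoszD iterzS -fL; exists (iterz f n x) => //;
  exact: IH.
have := IH Lx; rewrite -{1}fL => -[y Ly].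
rewrite (_ : - n%:Z = - n.+1%:Z + 1) ?iterzS;
  last by rewrite -addn1 PoszD opprD subrK.
by move=> /(can_inj (diffeo_funK f)) <-.
Qed.

Lemma locrep_id p x : chart_dom p x -> locrep id p p x = \1%VF.
Proof.
move=> px; apply/lfunP => u.
apply: (etrans (locrepE _ _ _ _ _)); apply: (etrans _ (esym (id_lfunE u))).
have : is_diff (chart p x) (chart p \o id \o chart_inv p) ('d id (chart p x)).
  apply: near_eq_is_diff; last exact: ex_diff.
  by apply: filterS (near_chart_inv px (nbhs_chart_dom px)) => a [_ /esym].
by move=> [_ /(congr1 (fun h => h u))] /= ->; rewrite diff_val.
Qed.

Lemma Dn0 x : Dn f 0 x = \1%VF.
Proof. exact: (locrep_id (chart_dom_center x)). Qed.

Lemma DnD n m x : Dn f (n + m) x = (Dn f m (iterz f n x) \o Dn f n x)%VF.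
Proof.
have E : iterz f (n + m) = iterz f m \o iterz f n.
  by apply/funext => y; rewrite iterzD.
rewrite /Dn /tangent_map E.
by apply: locrep_comp; do ?[exact: smooth_iterz|exact: chart_dom_center].
Qed.

Lemma DnK n x u : Dn f (- n) (iterz f n x) (Dn f n x u) = u.
Proof. by rewrite -comp_lfunE -DnD subrr Dn0 id_lfunE. Qed.

Lemma DnVK n x u : Dn f n x (Dn f (- n) (iterz f n x) u) = u.
Proof. by have := DnK (- n) (iterz f n x) u; rewrite opprK iterzK. Qed.

Lemma coord_changeK p q x u : chart_dom p x -> chart_dom q x ->
  coord_change q p x (coord_change p q x u) = u.
Proof.
move=> px qx; apply: (etrans (esym (comp_lfunE _ _ _))).
have E : locrep id p p x = (locrep id q p x \o locrep id p q x)%VF.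
  exact: (@locrep_comp _ _ _ id id p q p x (@smooth_id _ _ _)
    (@smooth_id _ _ _)).
apply: (etrans (congr1 (fun h : 'End(_) => h u) (esym E))).
by rewrite locrep_id// id_lfunE.
Qed.

End Iterates.

(** * Norms on the tangent bundle *)

Section TangentNorm.
Variables (R : realType) (d : nat) (M : closed_manifold R d).
Variable g : continuous_inner_product M.
Implicit Types (x y p : M) (u v : 'rV[R]_d).

Lemma ipD x u v w : g x (u + v) w = g x u w + g x v w.
Proof. by have := ip_linear g x 1 u v w; rewrite scale1r mul1r. Qed.

Lemma ip0 x w : g x 0 w = 0.
Proof. by have := ipD x 0 0 w; rewrite addr0 => /eqP;
  rewrite -subr_eq0 opprD addrA subrr sub0r oppr_eq0 => /eqP. Qed.

Lemma ipZ x a u w : g x (a *: u) w = a * g x u w.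
Proof. by have := ip_linear g x a u 0 w; rewrite addr0 ip0 addr0. Qed.

Lemma ip_ge0 x u : 0 <= g x u u.
Proof. by have [->|/ip_gt0/ltW//] := eqVneq u 0; rewrite ip0. Qed.

Lemma tnorm_ge0 x u : 0 <= tnorm g x u.
Proof. exact: sqrtr_ge0. Qed.

Lemma tnorm_gt0 x u : u != 0 -> 0 < tnorm g x u.
Proof. by move=> u0; rewrite sqrtr_gt0 ip_gt0. Qed.

Lemma tnorm0 x : tnorm g x 0 = 0.
Proof. by rewrite /tnorm ip0 sqrtr0. Qed.

Lemma tnormZ x a u : tnorm g x (a *: u) = `|a| * tnorm g x u.
Proof.
rewrite /tnorm ipZ ip_sym ipZ mulrA -expr2 sqrtrM ?sqr_ge0//.
by rewrite sqrtr_sqr.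
Qed.

Lemma tnormN x u : tnorm g x (- u) = tnorm g x u.
Proof. by rewrite -scaleN1r tnormZ normrN1 mul1r. Qed.

Lemma tnorm_cauchy_schwarz x u v : g x u v <= tnorm g x u * tnorm g x v.
Proof.
have [->|v0] := eqVneq v 0; first by rewrite ip_sym ip0 tnorm0 mulr0.
have [uv|uv] := leP (g x u v) 0.
  by apply: le_trans uv _; rewrite mulr_ge0 ?tnorm_ge0.
have gv := ip_gt0 g x v0.
(* Positivity of the component of u orthogonal to v. *)
have := ip_ge0 x (u - (g x u v / g x v v) *: v).
rewrite -scaleNr ipD (ip_sym g x u) (ip_sym g x (_ *: v)) !ipD !ipZ.
rewrite (ip_sym g x v u) !(ip_sym g x _ (_ *: v)) !ipZ (ip_sym g x v u).
have -> : g x u u + - (g x u v / g x v v) * g x u v + (- (g x u v / g x v v) *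
  g x u v + - (g x u v / g x v v) * (- (g x u v / g x v v) * g x v v)) = (g x u
  u * g x v v - g x u v ^+ 2) / g x v v by field; rewrite gt_eqF.
rewrite pmulr_lge0 ?invr_gt0// subr_ge0 => h.
rewrite /tnorm -sqrtrM ?ip_ge0// -(ger0_norm (ltW uv)) -sqrtr_sqr.
exact: ler_wsqrtr.
Qed.

Lemma tnormD x u v : tnorm g x (u + v) <= tnorm g x u + tnorm g x v.
Proof.
rewrite -(@ler_pXn2r _ 2) ?nnegrE ?addr_ge0 ?tnorm_ge0//.
rewrite sqrrD {1}/tnorm !sqr_sqrtr ?ip_ge0//.
rewrite ipD (ip_sym g x u (u + v)) (ip_sym g x v (u + v)) !ipD (ip_sym g x v u).
by have := tnorm_cauchy_schwarz x u v; rewrite /tnorm; lra.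
Qed.

Lemma tnorm_sum x (I : finType) (P : pred I) (u : I -> 'rV[R]_d) :
  tnorm g x (\sum_(i | P i) u i) <= \sum_(i | P i) tnorm g x (u i).
Proof.
elim/big_ind2: _ => //; first by rewrite tnorm0.
by move=> a b c e ab ce; apply: le_trans (tnormD _ _ _) _; exact: lerD.
Qed.

(** The norm of DF(x) applied to the tangent vector represented by u in the chart p, so that u can
    be kept fixed while x moves. For F = f^n these are the norms N n of [splits]. *)
Definition local_norm (F : M -> M) p x u : R :=
  tnorm g (F x) (tangent_map F x (coord_change p x x u)).

(** The definition passes through the chart around F x, which moves with x. Here the image is read
    in a fixed chart q, where the inner product is known to be continuous. *)
Lemma local_normE F p q x u : smooth F -> chart_dom p x -> chart_dom q (F x) ->
  local_norm F p x u =
  Num.sqrt (g (F x) (coord_change q (F x) (F x) (locrep F p q x u))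
                    (coord_change q (F x) (F x) (locrep F p q x u))).
Proof.
move=> sF px qFx; rewrite /local_norm /tnorm.
have E : tangent_map F x (coord_change p x x u) =
    coord_change q (F x) (F x) (locrep F p q x u).
  have E1 := @locrep_comp _ _ _ id F p x (F x) x (@smooth_id _ _ _) sF px
    (chart_dom_center x) (chart_dom_center (F x)).
  have E2 := @locrep_comp _ _ _ F id p q (F x) x sF (@smooth_id _ _ _) px
    qFx (chart_dom_center (F x)).
  have E3 := etrans (esym E1) E2.
  apply: (etrans (esym (comp_lfunE _ _ _))).
  apply: (etrans _ (comp_lfunE _ _ _)).
  exact: (congr1 (fun h : 'End(_) => h u) E3).
exact: (congr1 (fun w => Num.sqrt (g (F x) w w)) E).
Qed.

Lemma local_norm_continuous F p x u : smooth F -> chart_dom p x ->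
  {for (x, u), continuous (fun z : M * 'rV[R]_d => local_norm F p z.1 z.2)}.
Proof.
move=> sF px; pose q := F x; have qFx := chart_dom_center (F x).
pose h (z : M * 'rV[R]_d) :=
  Num.sqrt (g (F z.1) (coord_change q (F z.1) (F z.1) (locrep F p q z.1 z.2))
                    (coord_change q (F z.1) (F z.1) (locrep F p q z.1 z.2))).
have near1 : \forall z \near (x, u), h z = local_norm F p z.1 z.2.
  have near2 : \forall y \near x, chart_dom p y /\ chart_dom q (F y).
    by apply: filterI; [exact: nbhs_chart_dom|exact: (sF.1 x _ (nbhs_chart_dom
      qFx))].
  have near3 : \forall z \near (x, u), chart_dom p z.1 /\ chart_dom q (F z.1).
    exact: (@cvg_fst _ _ (nbhs x) (nbhs u) _ _ near2).
  apply: filterS near3 => z [pz qz].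
  exact: (esym (local_normE _ sF pz qz)).
apply: (cvg_trans (near_eq_cvg near1)).
suff ch : {for (x, u), continuous h}.
  exact: (eq_ind _ (fun l =>
    h @ (x, u) --> l) ch _ (esym (local_normE u sF px qFx))).
have cloc : {for (x, u), continuous (fun z : M * 'rV[R]_d =>
  locrep F p q z.1 z.2)}.
  apply: (@continuous_rV_apply _ _ _ _ (fun z : M * 'rV[R]_d =>
    locrep F p q z.1) snd).
    move=> v; apply: (@continuous_comp _ _ _ fst (fun y => locrep F p q y v)).
      exact: cvg_fst.
    exact: ((sF.2 p q x px qFx).2 v).
  exact: cvg_snd.
have cip : {for (q, (locrep F p q x u, locrep F p q x u)), continuous
   (fun z : M * ('rV[R]_d * 'rV[R]_d) =>
         g z.1 (coord_change q z.1 z.1 z.2.1) (coord_change q z.1 z.1 z.2.2))}.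
  have := ip_continuous (c := g) (p := q).
  rewrite continuous_open_subspace; last first.
    by rewrite setXT; apply: open_comp; [move=> *;
      exact: cvg_fst|exact: chart_dom_open].
  by apply; rewrite inE; split.
apply: (@continuous_comp _ _ _ (fun z : M * 'rV[R]_d =>
  g (F z.1) (coord_change q (F z.1) (F z.1) (locrep F p q z.1 z.2))
                    (coord_change q (F z.1) (F z.1)
                      (locrep F p q z.1 z.2))) Num.sqrt (x, u));
  last exact: sqrt_continuous.
apply: (@continuous_comp _ _ _ (fun z : M * 'rV[R]_d =>
  (F z.1, (locrep F p q z.1 z.2, locrep F p q z.1 z.2)))
  (fun z : M * ('rV[R]_d * 'rV[R]_d) =>
         g z.1 (coord_change q z.1 z.1 z.2.1) (coord_change q z.1 z.1 z.2.2))
           (x, u));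
  last exact: cip.
have cF : F z.1 @[z --> (x, u)] --> F x.
  apply: (@continuous_comp _ _ _ fst F (x, u)); [exact: cvg_fst|exact: sF.1].
exact: (cvg_pair cF (cvg_pair cloc cloc)).
Qed.

End TangentNorm.

(* Compactness of the unit sphere, with the bound K -> +oo as a parameter of
   the filter. *)
Lemma locally_uniform_bound (R : realType) (d : nat) (Y : topologicalType)
    (y0 : Y) (phi psi : Y -> 'rV[R]_d -> R) :
  (forall u, {for (y0, u), continuous (fun z => phi z.1 z.2)}) ->
  (forall u, {for (y0, u), continuous (fun z => psi z.1 z.2)}) ->
  (forall y a u, phi y (a *: u) = `|a| * phi y u) ->
  (forall y a u, psi y (a *: u) = `|a| * psi y u) ->
  (forall u, u != 0 -> 0 < psi y0 u) ->
  \forall y \near y0 & K \near +oo, forall u, phi y u <= K * psi y u.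
Proof.
move=> cphi cpsi hphi hpsi psi0.
pose S : set 'rV[R]_d := [set u | `|u| = 1].
have cS : compact S.
  apply: bounded_closed_compact.
    by exists 1; split; [exact: num_real|move=> x x1 u /= ->; exact: ltW].
  have -> : S = (fun u : 'rV[R]_d => `|u|) @^-1` [set 1] by [].
  by apply: closed_comp; [move=> *; exact: norm_continuous|exact: closed_eq].
suff : \forall i \near filter_prod (nbhs y0) (pinfty_nbhs R),
    S `<=` (fun u => phi i.1 u <= i.2 * psi i.1 u).
  apply: filterS => -[y K] /= hS u.
  have [->|u0] := eqVneq u 0.
    by have := hphi y 0 0; have := hpsi y 0 0;
      rewrite scale0r normr0 !mul0r => -> ->; rewrite mulr0.
  have nu : 0 < `|u| by rewrite normr_gt0.
  have := hS (`|u|^-1 *: u).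
  rewrite /S /= normrZ normfV normr_id mulVf ?gt_eqF// => /(_ erefl).
  by rewrite hphi hpsi mulrCA ler_pM2l// normfV normr_id invr_gt0.
have /compact_near_coveringP cov := cS.
apply: (cov (Y * R)%type _ (fun i u => phi i.1 u <= i.2 * psi i.1 u)).
move=> u Su.
have u0 : u != 0 by rewrite -normr_eq0 Su oner_eq0.
have pu := psi0 _ u0.
pose e := psi y0 u / 2.
have e0 : 0 < e by rewrite divr_gt0.
have n1 : \forall z \near (y0, u), phi z.1 z.2 < phi y0 u + 1.
  have := cphi u; move=> /(cvgr_lt (phi y0 u)); apply; by rewrite ltrDl.
have n2 : \forall z \near (y0, u), e < psi z.1 z.2.
  have := cpsi u; move=> /(cvgr_gt (psi y0 u)); apply.
  by rewrite /e ltr_pdivrMr// mulr_natr mulr2n ltrDl.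
pose K0 := Num.max 0 ((phi y0 u + 1) / e).
have [[A1 A2] /= [A1y A2u] A12] : \forall z \near (y0, u), phi z.1 z.2 < phi y0
  u + 1 /\ e < psi z.1 z.2.
  exact: filterI.
exists (A2, (A1 `*` [set K | K0 < K])) => /=.
  split => //; exists (A1, [set K | K0 < K]) => //=; split => //.
  by exists K0; split => //; exact: num_real.
move=> [u' [y' K]] /= [A2u' [A1y' K0K]].
have [/= h1 h2] := A12 (y', u') (conj A1y' A2u').
apply: le_trans (ltW h1) _.
have hK : (phi y0 u + 1) / e <= K.
  by apply: le_trans (ltW K0K); rewrite le_max lexx orbT.
have K0' : 0 <= K by apply: le_trans (ltW K0K); rewrite le_max lexx.
move: hK; rewrite ler_pdivrMr// => /le_trans; apply.
by rewrite ler_wpM2l// ltW.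
Qed.

(** * Operator norms, uniform bounds on Df^n over L, and matrices in charts *)

Section Bounds.
Variables (R : realType) (d : nat) (M : closed_manifold R d).
Variables (g : continuous_inner_product M) (f : diffeomorphism M).
Implicit Types (x y p : M) (u v : 'rV[R]_d).

Lemma tangent_map_id x : tangent_map id x = \1%VF :> 'End('rV[R]_d).
Proof. exact: (locrep_id (chart_dom_center x)). Qed.

Lemma local_norm_id p x u : local_norm g id p x u = tnorm g x (coord_change p x
  x u).
Proof.
exact: (congr1 (tnorm g x) (etrans (congr1 (fun h : 'End(_) => h _)
  (tangent_map_id x)) (id_lfunE _))).
Qed.

Lemma coord_change_id x u : coord_change x x x u = u.
Proof.
exact: (etrans (congr1 (fun h : 'End(_) => h u)
  (locrep_id (chart_dom_center x))) (id_lfunE _)).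
Qed.

Lemma coord_change_neq0 p x u : chart_dom p x -> u != 0 ->
  coord_change p x x u != 0.
Proof.
move=> px; apply: contra => /eqP u0.
apply/eqP; apply: (etrans (esym (coord_changeK u px (chart_dom_center x)))).
exact: (etrans (congr1 (coord_change x p x) u0) (linear0 _)).
Qed.

Lemma local_normZ F p x a u :
  local_norm g F p x (a *: u) = `|a| * local_norm g F p x u.
Proof.
rewrite /local_norm; move: (tangent_map F x) (coord_change p x x) => A B.
by rewrite !linearZ tnormZ.
Qed.

Lemma local_norm_id_gt0 p x u : chart_dom p x -> u != 0 ->
  0 < local_norm g id p x u.
Proof.
move=> px u0; rewrite local_norm_id; apply: tnorm_gt0.
exact: coord_change_neq0.
Qed.

Lemma tnorm_continuous x : continuous (tnorm g x).
Proof.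
move=> u; have h := @local_norm_continuous _ _ _ g _ _ _ u (@smooth_id _ _ M)
  (chart_dom_center x).
have -> : tnorm g x = (fun z : M * 'rV[R]_d =>
  local_norm g id x z.1 z.2) \o (fun v => (x, v)).
  by apply/funext => v; rewrite /= local_norm_id coord_change_id.
apply: (@continuous_comp _ _ _ (fun v => (x, v)) _ u); last exact: h.
have c1 : (fun _ : 'rV[R]_d => x) @ u --> x by apply: cst_continuous.
have c2 : (fun v : 'rV[R]_d => v) @ u --> u by exact: cvg_id.
exact: (cvg_pair c1 c2).
Qed.

(** Makes the supremum in [opnorm] meaningful, since [sup] takes a default value on unbounded sets.
    It is the local bound for functions that do not depend on the base point. *)
Lemma lfun_bounded x y (A : 'End('rV[R]_d)) :
  \forall K \near +oo, forall u, tnorm g y (A u) <= K * tnorm g x u.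
Proof.
have h := @locally_uniform_bound R d M x (fun _ u => tnorm g y (A u))
  (fun _ u => tnorm g x u).
have [|||||[A1 A2] /= [A1x A2K] A12] := h.
- move=> u; apply: (@continuous_comp _ _ _ (fun z : M * 'rV[R]_d => A z.2)
    (tnorm g y) (x, u)); last exact: tnorm_continuous.
  by apply: (@continuous_rV_apply _ _ _ _ (fun _ : M * 'rV[R]_d => A) snd);
    [move=> v; apply: cst_continuous|exact: cvg_snd].
- move=> u; apply: (@continuous_comp _ _ _ snd (tnorm g x) (x, u));
    last exact: tnorm_continuous.
  exact: cvg_snd.
- by move=> _ a u; rewrite linearZ tnormZ.
- by move=> _ a u; rewrite tnormZ.
- by move=> u; exact: tnorm_gt0.
by apply: filterS A2K => K K2; apply: (A12 (x, K)); split => //=;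
  exact: nbhs_singleton.
Qed.

Lemma le_opnorm x y (A : 'End('rV[R]_d)) u :
  tnorm g y (A u) <= opnorm g x y A * tnorm g x u.
Proof.
have [->|u0] := eqVneq u 0; first by rewrite linear0 !tnorm0 mulr0.
have nu := tnorm_gt0 g x u0.
rewrite -ler_pdivrMr//; apply: ub_le_sup.
  have : \forall K \near +oo, 0 <= K /\ forall u, tnorm g y (A u) <= K * tnorm
    g x u.
    by apply: filterI; [exact: nbhs_pinfty_ge|exact: lfun_bounded].
  move=> /(@filter_ex _ _ _)[K [K0 hK]]; exists K => _ [v /= v1 <-].
  by apply: le_trans (hK v) _; rewrite ler_piMr.
exists ((tnorm g x u)^-1 *: u) => /=.
  by rewrite tnormZ gtr0_norm ?invr_gt0// mulVf// gt_eqF.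
by rewrite linearZ tnormZ gtr0_norm ?invr_gt0// mulrC.
Qed.

Lemma opnorm_le x y (A : 'End('rV[R]_d)) K :
  0 <= K -> (forall u, tnorm g y (A u) <= K * tnorm g x u) ->
    opnorm g x y A <= K.
Proof.
move=> K0 hK; apply: ge_sup; first by exists (tnorm g y (A 0)), 0;
  rewrite //= tnorm0.
by move=> _ [v /= v1 <-]; apply: le_trans (hK v) _; rewrite ler_piMr.
Qed.

Lemma opnorm_ge0 x y (A : 'End('rV[R]_d)) : 0 <= opnorm g x y A.
Proof.
have [->|[u u0]] : A = 0 \/ exists u, A u != 0.
- have [[u u0]|h] := pselect (exists u, A u != 0); [by right; exists u|left].
  apply/lfunP => u; rewrite zero_lfunE; apply: contrapT => /eqP Au; apply: h.
  by exists u.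
- rewrite /opnorm; set S := (X in sup X); have -> : S = [set 0];
    last by rewrite sup1.
  apply/seteqP; split => [_ [v _ <-]|_ ->] /=;
    first by rewrite zero_lfunE tnorm0.
  by exists 0; rewrite /= ?zero_lfunE tnorm0.
have nu : 0 < tnorm g x u.
  by rewrite tnorm_gt0//; apply: contra u0 => /eqP ->; rewrite linear0.
by rewrite -(pmulr_lge0 _ nu) (le_trans _ (le_opnorm x y A u))// tnorm_ge0.
Qed.

(** Near each x the norms of Df^n u and of u are compared in the chart around x; compactness of L,
    with K as filter parameter, lets a single K serve all points. *)
Lemma Dn_uniform_bound (L : set M) n : compact L ->
  exists2 K, 0 <= K & forall x, L x -> forall u,
    tnorm g (iterz f n x) (Dn f n x u) <= K * tnorm g x u.
Proof.
move=> /compact_near_coveringP cov.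
have : \forall K \near +oo, L `<=` (fun x => forall u,
    tnorm g (iterz f n x) (Dn f n x u) <= K * tnorm g x u).
  apply: cov => x Lx.
  have := @locally_uniform_bound R d M x (fun y u =>
    local_norm g (iterz f n) x y u)
    (fun y u => local_norm g id x y u).
  case.
  - move=> u; exact: (@local_norm_continuous _ _ _ g _ _ _ u (smooth_iterz f n)
      (chart_dom_center x)).
  - move=> u; exact: (@local_norm_continuous _ _ _ g _ _ _ u (@smooth_id _ _ M)
      (chart_dom_center x)).
  - by move=> y a u; rewrite local_normZ.
  - by move=> y a u; rewrite local_normZ.
  - by move=> u; exact: (local_norm_id_gt0 (chart_dom_center x)).
  move=> [A1 A2] /= [A1x A2K] A12.
  exists (A1 `&` chart_dom x, A2) => /=.
    by split => //; apply: filterI => //;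
      exact: (nbhs_chart_dom (chart_dom_center x)).
  move=> [y K] /= [[A1y xy] A2K'] u.
  (* The local bound is applied to the representative, in the chart around x, of the tangent vector
     u at y. *)
  have := A12 (y, K) (conj A1y A2K') (coord_change y x y u).
  have E := coord_changeK u (chart_dom_center y) xy.
  rewrite local_norm_id => H.
  exact: (eq_ind _ (fun w => tnorm g (iterz f n y)
    (Dn f n y w) <= K * tnorm g y w)
    H _ E).
move=> h; have : \forall K \near +oo, 0 <= K /\ (L `<=` (fun x => forall u,
    tnorm g (iterz f n x) (Dn f n x u) <= K * tnorm g x u)).
  by apply: filterI; [exact: nbhs_pinfty_ge|exact: h].
by move=> /(@filter_ex _ _ _)[K [K0 hK]]; exists K.
Qed.

Lemma Dn_uniform_lower_bound (L : set M) n : compact L -> f @` L = L ->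
  exists2 K, 0 <= K & forall x, L x -> forall u,
    tnorm g x u <= K * tnorm g (iterz f n x) (Dn f n x u).
Proof.
move=> Lc fL; have [K K0 hK] := Dn_uniform_bound (- n) Lc.
exists K => // x Lx u; have E :=
  f_equal2 (tnorm g) (iterzK f n x) (DnK f n x u).
apply: (le_trans _ (hK _ (iterz_mem n fL Lx) _)).
by move: E; move: (Dn f (- n) (iterz f n x) (Dn f n x u)) => w ->.
Qed.

(** Matrix in the chart p of an endomorphism of T_xM, comparable for different x. As it acts on
    rows, it reverses compositions. *)
Definition localmx p x (A : 'End('rV[R]_d)) : 'M[R]_d :=
  lin1_mx (coord_change x p x \o A \o coord_change p x x)%VF.

Lemma mul_localmx p x A u :
  u *m localmx p x A = coord_change x p x (A (coord_change p x x u)).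
Proof.
rewrite /localmx; move: (coord_change p x x) (coord_change x p x) => B C.
by rewrite mul_rV_lin1 /= !comp_lfunE.
Qed.

Lemma local_norm_localmx F p x A u : chart_dom p x ->
  local_norm g F p x (u *m localmx p x A) =
  tnorm g (F x) (tangent_map F x (A (coord_change p x x u))).
Proof.
move=> px; rewrite mul_localmx.
exact: (congr1 (fun w => tnorm g (F x) (tangent_map F x w))
  (coord_changeK _ (chart_dom_center x) px)).
Qed.

Lemma localmx_comp p x A B : chart_dom p x ->
  localmx p x (A \o B)%VF = localmx p x B *m localmx p x A.
Proof.
move=> px; apply/row_matrixP => i; rewrite row_mul !rowE !mul_localmx.
have := fun w => @coord_changeK _ _ _ x p x w (chart_dom_center x) px.
move: (coord_change p x x) (coord_change x p x) => S T TS.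
by rewrite TS comp_lfunE.
Qed.

Lemma localmxD p x A B : localmx p x (A + B) = localmx p x A + localmx p x B.
Proof.
apply/row_matrixP => i; rewrite linearD /= !rowE !mul_localmx.
move: (coord_change p x x) (coord_change x p x) => S T.
by rewrite add_lfunE linearD.
Qed.

Lemma localmx1 p x : chart_dom p x -> localmx p x \1%VF = 1%:M.
Proof.
move=> px; apply/row_matrixP => i; rewrite !rowE mulmx1 mul_localmx.
have := fun w => @coord_changeK _ _ _ p x x w px (chart_dom_center x).
move: (coord_change p x x) (coord_change x p x) => S T TS.
by rewrite id_lfunE TS.
Qed.

Lemma localmxB p x A B : localmx p x (A - B) = localmx p x A - localmx p x B.
Proof. by apply/eqP; rewrite eq_sym subr_eq -localmxD subrK. Qed.

(** The change of coordinates is a conjugation, which the trace does not see. *)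
Lemma mxtrace_localmx p x A : chart_dom p x ->
  (A \o A)%VF = A -> \tr (localmx p x A) = (\dim (limg A))%:R.
Proof.
move=> px AA; rewrite /localmx.
have := fun w => @coord_changeK _ _ _ x p x w (chart_dom_center x) px.
move: (coord_change p x x) (coord_change x p x) => S T TS.
rewrite !lin1_mx_comp mulmxA mxtrace_mulC !mulmxA.
rewrite -lin1_mx_comp (_ : (_ \o _)%VF = \1%VF); last first.
  by apply/lfunP => u; rewrite comp_lfunE id_lfunE TS.
rewrite (_ : lin1_mx \1%VF = 1%:M) ?mul1mx; last first.
  by apply/row_matrixP => i; rewrite !rowE mul_rV_lin1 /= id_lfunE mulmx1.
by rewrite mxtrace_idempotent -?lin1_mx_comp ?AA// mxrank_lin1_mx.
Qed.

End Bounds.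

(** * Boundedness and continuity of dominated projectors *)

Section DominatedProjectors.
Variables (R : realType) (d : nat) (M : closed_manifold R d).
Variables (g : continuous_inner_product M) (f : diffeomorphism M) (L : set M).
Hypotheses (hLc : compact L) (hLf : f @` L = L).
Variables (k : nat) (P : 'I_k -> M -> 'End('rV[R]_d)).
Hypothesis suppP : supplementary L P.
Hypothesis invP : forall i, projector_invariant f L (P i).
Variable q : nat -> R.
Hypotheses (q_ge0 : forall n, 0 <= q n) (q_cvg0 : q @ \oo --> 0).
(** Free of quotients and stated from time 0 only: since L and the projectors are invariant, any
    other starting time n is reached by passing to f^n(x). *)
Hypothesis domP : forall i j : 'I_k, (i < j)%N -> forall x, L x ->
  forall (m : nat) (u v : 'rV[R]_d),
  tnorm g (iterz f m x) (Dn f m x (P i x u)) * tnorm g x (P j x v) <=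
  q m * (tnorm g x (P i x u) * tnorm g (iterz f m x) (Dn f m x (P j x v))).
Implicit Types (x y p : M) (u v : 'rV[R]_d) (i j : 'I_k).

Lemma supp_sum x u : L x -> \sum_i P i x u = u.
Proof. by move=> /suppP[+ _] => /lfunP/(_ u); rewrite sum_lfunE id_lfunE. Qed.

Lemma supp_orth x i j u : L x -> i != j -> P i x (P j x u) = 0.
Proof.
by move=> /suppP[_ +] ij => /(_ i j ij)/lfunP/(_ u);
  rewrite comp_lfunE zero_lfunE.
Qed.

Lemma supp_idem x i u : L x -> P i x (P i x u) = P i x u.
Proof.
move=> Lx; rewrite -[in RHS](supp_sum u Lx) linear_sum (bigD1 i)//= big1
  ?addr0//.
by move=> j ji; rewrite supp_orth// eq_sym.
Qed.

Lemma Dn_proj n i x u : L x -> Dn f n x (P i x u) = P i (iterz f n x)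
  (Dn f n x u).
Proof.
have D1 y w : L y -> Dn f 1 y (P i y w) = P i (iterz f 1 y) (Dn f 1 y w).
  by move=> Ly; have := invP i Ly => /lfunP/(_ w); rewrite !comp_lfunE.
have DS (m : int) y w : Dn f (m + 1) y w = Dn f 1 (iterz f m y) (Dn f m y w).
  exact: (etrans (congr1 (fun h : 'End(_) => h w) (DnD f m 1 y))
    (comp_lfunE _ _ _)).
elim/int_ind: n x u => [|n IH|n IH] x u Lx.
- by rewrite !Dn0 !id_lfunE.
- have -> : n.+1%:Z = n%:Z + 1 by rewrite -PoszD addn1.
  apply: (etrans (DS n x (P i x u))); apply: (etrans (congr1 _ (IH x u Lx))).
  apply: (etrans (D1 _ _ (iterz_mem n hLf Lx))).
  exact: (esym (f_equal2 (fun y w => P i y w) (iterzD f n 1 x) (DS n x u))).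
(* Towards negative times the identity is checked after one application of Df, which is
   injective. *)
have inj y (a b : 'rV[R]_d) : Dn f 1 y a = Dn f 1 y b -> a = b.
  by move=> ab; exact: (etrans (esym (DnK f 1 y a)) (etrans (congr1 _ ab)
    (DnK f 1 y b))).
set m := - n.+1%:Z; have E : - n%:Z = m + 1
  by rewrite /m -[n.+1]addn1 PoszD opprD subrK.
rewrite E in IH; apply: (inj (iterz f m x)).
apply: (etrans (esym (DS m x (P i x u)))); apply: (etrans (IH x u Lx)).
apply: (etrans _ (esym (D1 _ _ (iterz_mem m hLf Lx)))).
exact: (f_equal2 (fun y w => P i y w) (iterzD f m 1 x) (DS m x u)).
Qed.

(** The cumulated projection, onto the bundles of index below s in the numbering from 0; [P i] is
    [block i.+1 - block i]. *)
Definition block s x : 'End('rV[R]_d) := \sum_(i < k | (i < s)%N) P i x.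

Lemma blockE s x u : block s x u = \sum_(i < k | (i < s)%N) P i x u.
Proof. by rewrite sum_lfunE. Qed.

Lemma block_compl s x u : L x ->
  u - block s x u = \sum_(i < k | ~~ (i < s)%N) P i x u.
Proof.
move=> Lx; rewrite blockE; apply/eqP; rewrite subr_eq addrC eq_sym; apply/eqP.
have := supp_sum u Lx.
by rewrite (bigID (fun i : 'I_k => (i < s)%N)).
Qed.

Lemma block_proj s x i u : L x ->
  P i x (block s x u) = if (i < s)%N then P i x u else 0.
Proof.
move=> Lx; rewrite blockE linear_sum; case: ifPn => is_.
  rewrite (bigD1 i)//= supp_idem// big1 ?addr0// => j /andP[_ ji].
  by rewrite supp_orth// eq_sym.
rewrite big1// => j js /=; rewrite supp_orth//; apply: contraNneq is_ => ->.
exact: js.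
Qed.

Lemma block_idem s x u : L x -> block s x (block s x u) = block s x u.
Proof.
by move=> Lx; rewrite blockE [RHS]blockE; apply: eq_bigr => i is_;
  rewrite block_proj// is_.
Qed.

Lemma Dn_block n s x u : L x ->
  Dn f n x (block s x u) = block s (iterz f n x) (Dn f n x u).
Proof.
by move=> Lx; rewrite !blockE linear_sum; apply: eq_bigr => i _; exact: Dn_proj.
Qed.

Lemma q_small (D : R) : 0 <= D -> exists m : nat, D * q m <= 1.
Proof.
move=> D0; have : D * q n @[n --> \oo] --> D * 0 by exact: cvgMr.
rewrite mulr0 => /cvgr_le/(_ _ ltr01)[m _ /(_ m (leqnn m)) h].
by exists m.
Qed.

(** The bound is relative to the partial sum [block s x u] because each step separates the new
    bundle only from the sum of the earlier ones. For s = k the partial sum is u itself. *)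
Lemma partial_projections_bounded s : (s <= k)%N ->
  exists2 B, 0 <= B & forall x, L x -> forall u i, (i < s)%N ->
    tnorm g x (P i x u) <= B * tnorm g x (block s x u).
Proof.
elim: s => [|s IH] sk; first by exists 0.
have [B B0 hB] := IH (ltnW sk).
(* The 4 is the factor of [norm_bounded_of_angle]; [k%:R * B] is the cost of splitting the block
   into at most k components. *)
have [m hm] : exists m : nat, (4 * (k%:R * B)) * q m <= 1.
  by apply: q_small; rewrite !mulr_ge0.
have [K K0 hK] := @Dn_uniform_bound _ _ _ g f L m hLc.
have [K' K'0 hK'] := @Dn_uniform_lower_bound _ _ _ g f L m hLc hLf.
pose js := Ordinal sk.
pose B' := 2 + K * K'.
have B'0 : 0 <= B' by rewrite addr_ge0// mulr_ge0.
have key x u : L x -> tnorm g x (block s x u) <= B' * tnorm g x (block s x u +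
  P js x u).
  move=> Lx.
  apply: (norm_bounded_of_angle (N1 :=
    fun w => tnorm g (iterz f m x) (Dn f m x w))) => //.
  - by move=> w; exact: tnorm_ge0.
  - by move=> w; exact: tnorm_ge0.
  - by move=> w w'; exact: tnormD.
  - by move=> w w'; rewrite linearD; exact: tnormD.
  - by move=> w; exact: tnormN.
  - by move=> w; rewrite linearN tnormN.
  - by move=> w; exact: hK.
  - by move=> w; exact: hK'.
  have h1 : tnorm g (iterz f m x)
    (Dn f m x (block s x u)) * tnorm g x (P js x u) <=
     q m * (\sum_(i < k | (i < s)%N) tnorm g x (P i x u) *
       tnorm g (iterz f m x) (Dn f m x (P js x u))).
    rewrite blockE linear_sum.
    apply: le_trans (ler_wpM2r (tnorm_ge0 _ _ _) (tnorm_sum _ _ _ _)) _.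
    rewrite mulr_suml mulr_sumr; apply: ler_sum => i is_; exact: domP.
  have h2 : \sum_(i < k | (i < s)%N) tnorm g x (P i x u) *
       tnorm g (iterz f m x) (Dn f m x (P js x u)) <= 
      k%:R * B * (tnorm g x (block s x u) * tnorm g (iterz f m x)
        (Dn f m x (P js x u))).
    apply: le_trans (_ : _ <= \sum_(i < k) B * (tnorm g x (block s x u) * tnorm
      g (iterz f m x) (Dn f m x (P js x u)))) _.
      rewrite big_mkcond; apply: ler_sum => i _; case: ifPn => is_.
        rewrite mulrA; apply: ler_wpM2r; first exact: tnorm_ge0.
        exact: hB.
      by rewrite !mulr_ge0 ?tnorm_ge0.
    by rewrite sumr_const card_ord -[leLHS]mulr_natl mulrA.
  set a := tnorm g x (block s x u) in h2 *.
  set b := tnorm _ _ (Dn f m x (P js x u)) in h1 h2 *.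
  have ab : 0 <= a * b by rewrite mulr_ge0 ?tnorm_ge0.
  apply: le_trans (ler_wpM2l _ h1) _; first by [].
  apply: le_trans (_ : _ <= 4 * (q m * (k%:R * B * (a * b)))) _.
    by rewrite ler_wpM2l// ler_wpM2l.
  have := ler_wpM2r ab hm; rewrite mul1r; apply: le_trans.
  by rewrite le_eqVlt; apply/orP; left; apply/eqP; ring.
have blockS x u : block s.+1 x u = block s x u + P js x u.
  rewrite !blockE (bigD1 js) //= addrC; congr (_ + _).
  apply: eq_bigl => i; rewrite ltnS -val_eqE /= ltn_neqAle andbC.
  by [].
(* [B * B'] serves the earlier components, through the bound on the smaller block; [1 + B'] serves
   the new one, a difference of two consecutive blocks. *)
exists (B * B' + 1 + B'); first by rewrite !addr_ge0// mulr_ge0.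
move=> x Lx u i; rewrite ltnS leq_eqVlt blockS => is_.
have k0 := key x u Lx; set c := tnorm g x (block s x u + _) in k0 *.
have c0 : 0 <= c by exact: tnorm_ge0.
case/orP: is_ => [/eqP ijs|is_].
  have -> : i = js by exact: val_inj.
  apply: le_trans (_ : _ <= (1 + B') * c) _; last first.
    by rewrite ler_wpM2r// -addrA lerDr mulr_ge0.
  rewrite -{1}(addKr (block s x u) (P js x u)).
  apply: le_trans (tnormD _ _ _ _) _; rewrite tnormN mulrDl mul1r addrC.
  by rewrite lerD2l.
apply: le_trans (hB x Lx u i is_) _.
apply: le_trans (ler_wpM2l B0 k0) _; rewrite mulrA ler_wpM2r//.
by rewrite -addrA lerDl addr_ge0.
Qed.

Lemma projections_bounded : exists2 B, 0 <= B &
  forall x, L x -> forall u i, tnorm g x (P i x u) <= B * tnorm g x u.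
Proof.
have [B B0 hB] := partial_projections_bounded (leqnn k).
exists B => // x Lx u i; have := hB x Lx u i (ltn_ord i).
rewrite blockE (eq_bigl predT) ?supp_sum// => j.
exact: ltn_ord.
Qed.

Lemma block_bounded s : exists2 B, 0 <= B & forall x, L x -> forall u,
  tnorm g x (block s x u) <= B * tnorm g x u /\
  tnorm g x (u - block s x u) <= B * tnorm g x u.
Proof.
have [B B0 hB] := projections_bounded.
exists (k%:R * B) => [|x Lx u]; first by rewrite mulr_ge0.
have sumB (I : pred 'I_k) : tnorm g x (\sum_(i | I i) P i x u) <= k%:R * B *
  tnorm g x u.
  apply: le_trans (tnorm_sum _ _ _ _) _.
  apply: le_trans (_ : _ <= \sum_(i < k) B * tnorm g x u) _; last first.
    by rewrite sumr_const card_ord -[leLHS]mulr_natl mulrA.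
  rewrite big_mkcond; apply: ler_sum => i _; case: ifP => _; first exact: hB.
  by rewrite mulr_ge0// tnorm_ge0.
by split; [rewrite blockE; exact: sumB|rewrite block_compl//; exact: sumB].
Qed.

(** Expanding both factors gives at most k^2 pairs i < s <= j. Each pair is dominated, and B bounds
    a component by its block, once at x and once at f^m(x). *)
Lemma block_dominated s : exists2 D, 0 <= D & forall x, L x ->
  forall (m : nat) u v,
  tnorm g (iterz f m x) (Dn f m x (block s x u)) * tnorm g x (v - block s x v)
    <=
  D * q m * (tnorm g x (block s x u) *
             tnorm g (iterz f m x) (Dn f m x (v - block s x v))).
Proof.
have [B B0 hB] := projections_bounded.
exists ((k * k)%:R * (B * B)) => [|x Lx m u v]; first by rewrite !mulr_ge0.
set a := block s x u; set b := v - block s x v.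
have Lfx : L (iterz f m x) by exact: iterz_mem.
have bi i : ~~ (i < s)%N -> P i x b = P i x v.
  by move=> /negbTE is_; rewrite /b linearB /= block_proj// is_ subr0.
have ai i : (i < s)%N -> P i x a = P i x u.
  by move=> is_; rewrite /a block_proj// is_.
pose X := q m * (B * tnorm g x a * (B * tnorm g (iterz f m x) (Dn f m x b))).
have X0 : 0 <= X by rewrite !mulr_ge0 ?tnorm_ge0.
have -> : (k * k)%:R * (B * B) * q m *
    (tnorm g x a * tnorm g (iterz f m x)
      (Dn f m x b)) = \sum_(i < k) \sum_(j < k) X.
  by rewrite !sumr_const card_ord -mulrnA -[RHS]mulr_natl /X; ring.
have -> : a = \sum_(i < k | (i < s)%N) P i x u by rewrite /a blockE.
have -> : tnorm g x b = tnorm g x (\sum_(j < k | ~~ (j < s)%N) P j x v).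
  by rewrite /b block_compl.
rewrite linear_sum.
apply: le_trans (_ : _ <= (\sum_(i < k | (i < s)%N) tnorm g (iterz f m x)
  (Dn f m x (P i x u)))
   * (\sum_(j < k | ~~ (j < s)%N) tnorm g x (P j x v))) _.
  by apply: ler_pM; rewrite ?tnorm_ge0//; exact: tnorm_sum.
rewrite big_distrlr /= big_mkcond; apply: ler_sum => i _.
case: ifPn => is_; last by apply: sumr_ge0.
rewrite big_mkcond; apply: ler_sum => j _; case: ifPn => // js.
have ij : (i < j)%N by rewrite (leq_trans is_)// leqNgt.
apply: le_trans (domP ij Lx m u v) _; apply: ler_wpM2l => //.
apply: ler_pM; rewrite ?tnorm_ge0//; first by rewrite -ai//; exact: hB.
rewrite -bi//.
apply: (eq_ind_r (fun w => tnorm g _ w <= _) _ (Dn_proj m j b Lx)).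
exact: hB.
Qed.

Lemma local_norm_iterz_gt0 n p x u : chart_dom p x -> u != 0 ->
  0 < local_norm g (iterz f n) p x u.
Proof.
move=> px u0; apply: tnorm_gt0.
have c0 : coord_change p x x u != 0 by exact: coord_change_neq0.
apply: contra c0 => /eqP D0; apply/eqP.
apply: (etrans (esym (DnK f n x _))).
exact: (etrans (congr1 (Dn f (- n) (iterz f n x)) D0) (linear0 _)).
Qed.

Lemma local_norm_lim p x (G : set_system M) (v : M -> 'rV[R]_d) w n :
  Filter G -> chart_dom p x -> G --> x -> v @ G --> w ->
  local_norm g (iterz f n) p y (v y) @[y --> G] --> local_norm g (iterz f n) p
    x w.
Proof.
move=> FG px Gx vw.
have c := @local_norm_continuous _ _ _ g _ _ _ w (smooth_iterz f n) px.
have pr : (fun y => (y, v y)) @ G --> (x, w) by exact: (cvg_pair Gx vw).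
exact: (cvg_comp _ _ pr c).
Qed.

Lemma splits_lim (B : R) (r : nat -> R) (tau : R) p x (G : set_system M)
    (A : M -> 'M[R]_d) (A0 : 'M[R]_d) :
  ProperFilter G -> chart_dom p x -> G --> x ->
  (forall a b, A y a b @[y --> G] --> A0 a b) ->
  (\forall y \near G, splits B r tau (fun n => local_norm g (iterz f n) p y)
    (A y)) -> splits B r tau (fun n => local_norm g (iterz f n) p x) A0.
Proof.
move=> FG px Gx cA sA.
have c1 : forall a b, (1%:M - A y) a b @[y --> G] --> (1%:M - A0) a b.
  move=> a b; rewrite !mxE; under eq_cvg do rewrite !mxE.
  by apply: cvgB; [exact: cvg_cst|exact: cA].
have cu (u : 'rV[R]_d) a b : (fun _ : M => u) t a b @[t --> G] --> u a b
  by exact: cvg_cst.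
have cuA (u : 'rV[R]_d) : (fun y => u *m A y) @ G --> u *m A0.
  by apply: mx_cvg; apply: (mulmx_cvg (A := fun=> u)).
have cuA1 (u : 'rV[R]_d) : (fun y =>
  u *m (1%:M - A y)) @ G --> u *m (1%:M - A0).
  by apply: mx_cvg; apply: (mulmx_cvg (A := fun=> u) (C :=
    fun y => 1%:M - A y)).
have cc (u : 'rV[R]_d) : (fun _ : M => u) @ G --> u by exact: cvg_cst.
have NA n u : local_norm g (iterz f n) p y (u *m A y) @[y --> G] -->
    local_norm g (iterz f n) p x (u *m A0) by exact: local_norm_lim.
have NA1 n u : local_norm g (iterz f n) p y (u *m (1%:M - A y)) @[y --> G] -->
    local_norm g (iterz f n) p x (u *m (1%:M - A0)) by exact: local_norm_lim.
have Nu n u : local_norm g (iterz f n) p y u @[y --> G] -->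
    local_norm g (iterz f n) p x u by exact: (local_norm_lim (v := fun=> u)).
have le_lim (h h' : M -> R) (l l' : R) : h @ G --> l -> h' @ G --> l' ->
    (\forall y \near G, h y <= h' y) -> l <= l'.
  exact: ler_cvg_to.
have eq_lim (h h' : M -> R) (l l' : R) : h @ G --> l -> h' @ G --> l' ->
    (\forall y \near G, h y = h' y) -> l = l'.
  move=> hl hl' hh; apply/le_anti/andP; split.
    by apply: (le_lim _ _ _ _ hl hl'); apply: filterS hh => y ->.
  by apply: (le_lim _ _ _ _ hl' hl); apply: filterS hh => y ->.
split.
- apply/matrixP => a b; have h1 : (A y *m A y) a b @[y --> G] --> (A0 *m A0) a b
    by apply: mulmx_cvg.
  apply: (eq_lim _ _ _ _ h1 (cA a b)).
  by apply: filterS sA => y [-> _ _ _ _].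
- apply: (eq_lim (fun y => \tr (A y)) (fun=> tau)); last 1 first.
  + by apply: filterS sA => y [_ -> _ _ _].
  + by apply: cvg_big => [|j _]; [exact: add_continuous|exact: cA].
  + exact: cvg_cst.
- move=> n u; apply: (le_lim _ _ _ _ (NA n u) (cvgM (cvg_cst B) (Nu n u))).
  by apply: filterS sA => y [_ _ h _ _]; exact: h.
- move=> n u; apply: (le_lim _ _ _ _ (NA1 n u) (cvgM (cvg_cst B) (Nu n u))).
  by apply: filterS sA => y [_ _ _ h _]; exact: h.
- move=> n m u v; apply: (le_lim _ _ _ _ (cvgM (NA (n + m) u) (NA1 n v))
    (cvgM (cvg_cst (r m)) (cvgM (NA n u) (NA1 (n + m) v)))).
  by apply: filterS sA => y [_ _ _ _ h]; exact: h.
Qed.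

Lemma local_norm_block n s p x u : L x -> chart_dom p x ->
  local_norm g (iterz f n) p x (u *m localmx p x (block s x)) =
  tnorm g (iterz f n x) (Dn f n x (block s x (coord_change p x x u))).
Proof. by move=> Lx px; exact: local_norm_localmx. Qed.

Lemma local_norm_blockC n s p x u : L x -> chart_dom p x ->
  local_norm g (iterz f n) p x (u *m (1%:M - localmx p x (block s x))) =
  tnorm g (iterz f n x)
    (Dn f n x (coord_change p x x u - block s x (coord_change p x x u))).
Proof.
move=> Lx px; rewrite -(localmx1 px) -localmxB.
apply: (etrans (local_norm_localmx _ _ _ _ px)).
apply: (congr1 (fun w => tnorm g (iterz f n x) (Dn f n x w))).
move: (coord_change p x x u) => w.
by rewrite add_lfunE opp_lfunE id_lfunE.
Qed.

Lemma Dn_blockC n s x u : L x ->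
  Dn f n x (u - block s x u) = Dn f n x u - block s (iterz f n x) (Dn f n x u).
Proof.
move=> Lx; apply: (etrans (linearB _ _ _)).
exact: (congr1 (fun w => _ - w) (Dn_block n s u Lx)).
Qed.

Lemma tnorm_DnD n m x u :
  tnorm g (iterz f (n + m) x) (Dn f (n + m) x u) =
  tnorm g (iterz f m (iterz f n x)) (Dn f m (iterz f n x) (Dn f n x u)).
Proof.
exact: (f_equal2 (tnorm g) (iterzD f n m x)
  (etrans (congr1 (fun h : 'End(_) => h u) (DnD f n m x)) (comp_lfunE _ _ _))).
Qed.

(** The constants depend neither on x nor on the chart, which is what the passage to the limit
    requires. *)
Lemma block_splits s (dims : 'I_k -> nat) :
  (forall i, projector_dim L (P i) (dims i)) ->
  exists B D, [/\ 0 <= B, 0 <= D & forall p x, L x -> chart_dom p x ->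
    splits B (fun m => D * q m) (\sum_(i < k | (i < s)%N) (dims i)%:R)
      (fun n => local_norm g (iterz f n) p x) (localmx p x (block s x))].
Proof.
move=> dimP; have [B B0 hB] := block_bounded s; have [D D0 hD] :=
  block_dominated s.
exists B, D; split => // p x Lx px; split.
- rewrite -localmx_comp//; congr (localmx p x _); apply/lfunP => u.
  by rewrite comp_lfunE block_idem.
- have -> : localmx p x (block s x) = \sum_(i < k | (i < s)%N) localmx p x (P i
    x).
    have localmx0 : localmx p x 0 = 0
      by rewrite -[X in localmx _ _ X](subrr 0) localmxB subrr.
    rewrite /block; apply: (big_morph (localmx p x) (localmxD p x) localmx0).
  rewrite raddf_sum /=; apply: eq_bigr => i _; rewrite mxtrace_localmx//.
    by rewrite dimP.
  by apply/lfunP => u; rewrite comp_lfunE supp_idem.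
- move=> n u; apply: (eq_ind_r (fun r =>
    r <= _) _ (local_norm_block n s u Lx px)).
  apply: (eq_ind_r (fun w => tnorm g _ w <= _) _ (Dn_block n s _ Lx)).
  exact: (hB _ (iterz_mem n hLf Lx) _).1.
- move=> n u; apply: (eq_ind_r (fun r =>
    r <= _) _ (local_norm_blockC n s u Lx px)).
  apply: (eq_ind_r (fun w => tnorm g _ w <= _) _ (Dn_blockC n s _ Lx)).
  exact: (hB _ (iterz_mem n hLf Lx) _).2.
move=> n m u v.
have transport (a b c e e' a' b' c' e1 : R) : a = a' -> b = b' -> c = c' ->
  e = e' ->
    a' * b' <= e1 * (c' * e') -> a * b <= e1 * (c * e) by move=> -> -> -> ->.
(* Domination from time n to n + m at x is domination from time 0 to m at f^n(x), for the images of
   the vectors under Df^n. *)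
have Lnx := iterz_mem n hLf Lx.
have := hD _ Lnx m (Dn f n x (coord_change p x x u))
  (Dn f n x (coord_change p x x v)).
apply: transport.
- apply: (etrans (local_norm_block (n + m) s u Lx px)).
  apply: (etrans (tnorm_DnD _ _ _ _)).
  exact: (congr1 (fun w => tnorm g _ (Dn f m _ w)) (Dn_block n s _ Lx)).
- apply: (etrans (local_norm_blockC n s v Lx px)).
  exact: (congr1 (fun w => tnorm g _ w) (Dn_blockC n s _ Lx)).
- apply: (etrans (local_norm_block n s u Lx px)).
  exact: (congr1 (fun w => tnorm g _ w) (Dn_block n s _ Lx)).
- apply: (etrans (local_norm_blockC (n + m) s v Lx px)).
  apply: (etrans (tnorm_DnD _ _ _ _)).
  exact: (congr1 (fun w => tnorm g _ (Dn f m _ w)) (Dn_blockC n s _ Lx)).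
Qed.

Lemma block_cvg s p x (dims : 'I_k -> nat) :
  (forall i, projector_dim L (P i) (dims i)) -> L x -> chart_dom p x ->
  forall a b, localmx p y (block s y) a b @[y --> within L (nbhs x)] -->
              localmx p x (block s x) a b.
Proof.
move=> dimP Lx px a b; have [B [D [B0 D0 sp]]] := block_splits s dimP.
have FF : ProperFilter (within L (nbhs x)).
  apply: Build_ProperFilter_ex => W; rewrite /within => /nbhs_singleton h.
  by exists x; exact: h.
apply: cvg_ultra => G GU FG; have GP : ProperFilter G by exact: ultra_proper.
have Gx : G --> x by move=> W xW; apply: FG; rewrite /within;
  apply: filterS xW => ? ? ?.
have GL : \forall y \near G, L y by apply: FG; exact: withinT.
have Gp : \forall y \near G, chart_dom p y by exact: (Gx _ (nbhs_chart_dom px)).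
have Gsp : \forall y \near G, splits B (fun m => D * q m)
  (\sum_(i < k | (i < s)%N) (dims i)%:R)
      (fun n => local_norm g (iterz f n) p y) (localmx p y (block s y)).
  by apply: filterS (filterI GL Gp) => y [Ly py]; exact: sp.
have N0c (u : 'rV[R]_d) :=
  @local_norm_continuous _ _ _ g _ _ _ u (smooth_iterz f 0) px.
(* The entry is a coordinate of the row ['e_a' *m localmx p y (block s y)]. Near x a coordinate is
   at most K times the norm, the block costs a factor B, and the norm of ['e_a'] is at most its
   value at x plus 1. *)
have bnd a' b' : exists c, \forall y \near G, `|localmx p y (block s y) a' b'|
  <= c.
  have [||||| [A1 A2] /= [A1x A2K] A12] :=
    @locally_uniform_bound R d M x (fun _ u => `|u 0 b'|)
    (fun y u => local_norm g (iterz f 0) p y u).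
  - move=> u; apply: (@continuous_comp _ _ _ (fun z : M * 'rV[R]_d => z.2 0 b')
      (fun r : R => `|r|) (x, u)); last exact: norm_continuous.
    apply: (@continuous_comp _ _ _ snd (fun v : 'rV[R]_d => v 0 b') (x, u)).
      exact: cvg_snd.
    exact: coord_continuous.
  - exact: N0c.
  - by move=> y c u; rewrite mxE normrM.
  - by move=> y c u; exact: local_normZ.
  - by move=> u; exact: local_norm_iterz_gt0.
  have [K [K0 A2K0]] : exists K, 0 <= K /\ A2 K.
    have := @filter_ex _ (pinfty_nbhs R) _ _ (filterI (nbhs_pinfty_ge (num_real
      0)) A2K).
    by move=> [K [? ?]]; exists K.
  exists (K * (B * (local_norm g (iterz f 0) p x 'e_a' + 1))).
  have near1 : \forall y \near G, local_norm g (iterz f 0) p y 'e_a' <=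
    local_norm g (iterz f 0) p x 'e_a' + 1.
    have lm : local_norm g (iterz f 0) p y 'e_a' @[y --> G] --> local_norm g
      (iterz f 0) p x 'e_a'.
      by apply: (@local_norm_lim p x G (fun=> 'e_a')) => //; exact: cvg_cst.
    have lt1 : local_norm g (iterz f 0) p x 'e_a' < local_norm g (iterz f 0) p
      x 'e_a' + 1.
      by rewrite ltrDl.
    exact: (cvgr_le _ lm _ lt1).
  apply: filterS (filterI Gsp (filterI near1 (Gx _ A1x))) =>
    y [[_ _ h _ _] [h1 A1y]].
  have := A12 (y, K) (conj A1y A2K0) ('e_a' *m localmx p y (block s y)).
  rewrite -rowE mxE; move=> /le_trans; apply; apply: ler_wpM2l => //.
  rewrite rowE; apply: (le_trans (h 0 'e_a')).
  exact: ler_wpM2l.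
have [A0 cA0] : exists A0 : 'M[R]_d, forall a' b',
    localmx p y (block s y) a' b' @[y --> G] --> A0 a' b'.
  have ex a' b' : exists l : R, localmx p y (block s y) a' b' @[y --> G] --> l.
    by have [c hc] := bnd a' b'; exact: ultra_bounded_cvg hc.
  exists (\matrix_(a', b') projT1 (cid (ex a' b'))) => a' b'; rewrite mxE.
  exact: (projT2 (cid (ex a' b'))).
have spx := splits_lim _ px Gx cA0 Gsp.
suff -> : localmx p x (block s x) = A0 by exact: cA0.
have N0 n u : u != 0 -> 0 < local_norm g (iterz f n) p x u
  by exact: local_norm_iterz_gt0.
have r0 m : 0 <= D * q m by rewrite mulr_ge0.
have rcvg : D * q m @[m --> \oo] --> 0.
  by rewrite -[X in _ --> X](mulr0 D); apply: cvgM;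
    [exact: cvg_cst|exact: q_cvg0].
(* The limit and the matrix at x satisfy the same conditions for the norms at the one point x. *)
exact: (splits_unique N0 B0 r0 rcvg (sp p x Lx px) (spx GP)).
Qed.

Lemma proj_bundle_continuous i (dims : 'I_k -> nat) :
  (forall i, projector_dim L (P i) (dims i)) -> bundle_continuous L (P i).
Proof.
move=> dimP p; apply/subspace_continuousP => -[x u] [[/= Lx px] _].
have E : (fun z : M * 'rV[R]_d =>
  coord_change z.1 p z.1 (P i z.1 (coord_change p z.1 z.1 z.2))) =
  (fun z => z.2 *m (localmx p z.1 (block i.+1 z.1) - localmx p z.1 (block i
    z.1))).
  apply/funext => z; rewrite -localmxB (_ : block i.+1 z.1 - block i z.1 = P i
    z.1) ?mul_localmx//.
  apply/eqP; rewrite subr_eq /block (bigD1 i)//=; apply/eqP; congr (_ + _).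
  by apply: eq_bigl => j; rewrite ltnS -val_eqE /= ltn_neqAle andbC.
rewrite E; set F := within _ _.
have F1 : fst @ F --> within L (nbhs x).
  move=> W WL; have h : nbhs (x, u) (fun z : M * 'rV[R]_d => L z.1 -> W z.1).
    exact: (@cvg_fst _ _ (nbhs x) (nbhs u) _ _ WL).
  by rewrite /F /within; apply: filterS h => z h [[Lz _] _]; exact: h.
have F2 : snd @ F --> u.
  move=> W Wu; have h : nbhs (x, u) (fun z : M * 'rV[R]_d => W z.2).
    exact: (@cvg_snd _ _ (nbhs x) (nbhs u) _ _ Wu).
  by rewrite /F /within; apply: filterS h => z Wz _.
apply: mx_cvg => a b; apply: mulmx_cvg => [a' b'|a' b'].
  exact: (cvg_comp _ _ F2 (@coord_continuous _ _ _ a' b' u)).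
apply: (@subr_mx_cvg _ _ _ _ _ (fun z : M * 'rV[R]_d =>
  localmx p z.1 (block i.+1 z.1))
  (fun z => localmx p z.1 (block i z.1))) => c e.
  exact: (cvg_comp _ _ F1 (@block_cvg i.+1 p x dims dimP Lx px c e)).
exact: (cvg_comp _ _ F1 (@block_cvg i p x dims dimP Lx px c e)).
Qed.

End DominatedProjectors.

(** * Splittings and projectors *)

Lemma daddv_pi_sum (F : fieldType) (V : vectType F) k (U : 'I_k -> {vspace V})
    (w : 'I_k -> V) i :
  directv (\sum_i U i)%VS -> (forall j, w j \in U j) ->
  daddv_pi (U i) (\sum_(j | j != i) U j)%VS (\sum_j w j) = w i.
Proof.
move=> /directv_sumP dU wU; have UI := dU i isT.
pose r := \sum_(j | j != i) w j.
have -> : \sum_j w j = w i + r by rewrite (bigD1 i).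
rewrite linearD /= daddv_pi_id//.
have rU : r \in (\sum_(j | j != i) U j)%VS by apply: memv_sumr => j _;
  exact: wU.
have := daddv_pi_add UI (memv_add (mem0v _) rU).
rewrite add0r [X in _ + X = _]daddv_pi_id//; last by rewrite capvC.
by move=> /(canRL (addrK _)) ->; rewrite subrr addr0.
Qed.

Lemma sum_pick (V : zmodType) k (i : 'I_k) (v : V) :
  \sum_j (if j == i then v else 0) = v.
Proof. by rewrite -big_mkcond big_pred1_eq. Qed.

(** Where the guarded quotient says nothing, a factor of the denominator vanishes, and with it the
    matching factor of the numerator. For dominated splittings this holds because Df^n is
    injective. *)
Lemma ler_of_ratio (R : realFieldType) (a b c e D : R) : 0 <= c -> 0 <= e ->
  (c = 0 -> a = 0) -> (e = 0 -> b = 0) ->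
  (c * e != 0 -> a * b / (c * e) <= D) -> a * b <= D * (c * e).
Proof.
move=> c0 e0 ca eb; have [/eqP|ce /(_ isT)] := eqVneq (c * e) 0.
  rewrite mulf_eq0 => /orP[] /eqP z _; first by rewrite z ca// !mul0r mulr0.
  by rewrite z eb// !mulr0.
by rewrite ler_pdivrMr// lt_neqAle eq_sym ce mulr_ge0.
Qed.

Section Splittings.
Variables (R : realType) (d : nat) (M : closed_manifold R d).
Variables (g : continuous_inner_product M) (f : diffeomorphism M) (L : set M).
Variables (k : nat).
Implicit Types (x y : M) (u v : 'rV[R]_d) (i j : 'I_k).

Lemma oblique_proj_sum (E : 'I_k -> M -> {vspace 'rV[R]_d}) x (w : 'I_k ->
  'rV[R]_d) i :
  invariant_splitting f L E -> L x -> (forall j, w j \in E j x) ->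
  oblique_proj E i x (\sum_j w j) = w i.
Proof. by move=> spE /spE[dE _ _] wE; exact: daddv_pi_sum. Qed.

Lemma oblique_proj_id (E : 'I_k -> M -> {vspace 'rV[R]_d}) x i j u :
  invariant_splitting f L E -> L x -> u \in E j x ->
  oblique_proj E i x u = if i == j then u else 0.
Proof.
move=> spE Lx uE; rewrite -{1}(sum_pick j u) (oblique_proj_sum _ spE)//.
by move=> l; case: eqP => [->//|_]; exact: mem0v.
Qed.

Lemma splitting_decomposition (E : 'I_k -> M -> {vspace 'rV[R]_d}) x u :
  invariant_splitting f L E -> L x ->
  exists2 w : 'I_k -> 'rV[R]_d, forall j, w j \in E j x & u = \sum_j w j.
Proof.
move=> spE /spE[_ sE _]; have : u \in (\sum_i E i x)%VS by rewrite sE memvf.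
by move=> /memv_sumP[w wE ->]; exists w => // j; exact: wE.
Qed.

Lemma oblique_proj_supplementary (E : 'I_k -> M -> {vspace 'rV[R]_d}) :
  invariant_splitting f L E -> supplementary L (oblique_proj E).
Proof.
move=> spE x Lx; split.
  apply/lfunP => u; rewrite sum_lfunE id_lfunE.
  have [w wE ->] := splitting_decomposition u spE Lx.
  by apply: eq_bigr => i _; rewrite (oblique_proj_sum _ spE).
move=> i j ij; apply/lfunP => u; rewrite comp_lfunE zero_lfunE.
rewrite (oblique_proj_id _ (j := j) spE Lx) ?(negbTE ij)//.
exact: memv_pi.
Qed.

Lemma oblique_proj_invariant (E : 'I_k -> M -> {vspace 'rV[R]_d}) i :
  f @` L = L -> invariant_splitting f L E ->
  projector_invariant f L (oblique_proj E i).
Proof.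
move=> fL spE x Lx; have Lfx : L (f x) by rewrite -fL; exists x.
apply/lfunP => u; rewrite !comp_lfunE.
have [w wE ->] := splitting_decomposition u spE Lx.
have [_ _ TE] := spE x Lx.
rewrite (oblique_proj_sum _ spE Lx wE); move: TE;
  move: (tangent_map f x) => T TE.
rewrite linear_sum (@oblique_proj_sum _ (f x) (fun j => T (w j)) i spE)//.
by move=> j; rewrite -TE memv_img.
Qed.

Lemma limg_oblique_proj (E : 'I_k -> M -> {vspace 'rV[R]_d}) i x :
  invariant_splitting f L E -> L x -> limg (oblique_proj E i x) = E i x.
Proof.
move=> spE Lx; apply/eqP; rewrite eqEsubv; apply/andP; split; apply/subvP => v.
  by move=> /memv_imgP[u _ ->]; exact: memv_pi.
move=> vE; apply/memv_imgP; exists v; first exact: memvf.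
by rewrite (oblique_proj_id _ spE Lx vE) eqxx.
Qed.

Lemma tnorm_Dn_gt0 n x u : u != 0 -> 0 < tnorm g (iterz f n x) (Dn f n x u).
Proof.
move=> u0; apply: tnorm_gt0; apply: contra u0 => /eqP D0; apply/eqP.
apply: (etrans (esym (DnK f n x u))).
exact: (etrans (congr1 (Dn f (- n) (iterz f n x)) D0) (linear0 _)).
Qed.

Lemma tnorm_Dn0 n x : tnorm g (iterz f n x) (Dn f n x 0) = 0.
Proof. by move: (Dn f n x) => A; rewrite linear0 tnorm0. Qed.

(** The bound passes to the suprema one factor at a time: over u for fixed v, then over v. *)
Lemma opnormM_le x y (A B : 'End('rV[R]_d)) D : 0 <= D ->
  (forall u v, tnorm g y (A u) * tnorm g x (B v) <= D * (tnorm g x u * tnorm g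
    y v)) ->
  opnorm g x y A * opnorm g y x B <= D.
Proof.
move=> D0 hAB.
have [->|A0] := eqVneq (opnorm g x y A) 0; first by rewrite mul0r.
have Agt0 : 0 < opnorm g x y A by rewrite lt_neqAle eq_sym A0 opnorm_ge0.
rewrite mulrC -ler_pdivlMr//; apply: opnorm_le; first by rewrite divr_ge0// ltW.
move=> v; rewrite mulrAC ler_pdivlMr//.
have [->|Bv] := eqVneq (tnorm g x (B v)) 0.
  by rewrite mul0r mulr_ge0// tnorm_ge0.
have Bvgt0 : 0 < tnorm g x (B v) by rewrite lt_neqAle eq_sym Bv tnorm_ge0.
rewrite mulrC -ler_pdivlMr//; apply: opnorm_le.
  by rewrite divr_ge0 ?mulr_ge0 ?tnorm_ge0.
move=> u; rewrite mulrAC ler_pdivlMr//; have := hAB u v.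
by rewrite (mulrC (tnorm g x u)) mulrA.
Qed.

Definition dominated_mul (P : 'I_k -> M -> 'End('rV[R]_d)) (C alpha : R) i j :=
  forall x, L x -> forall (n m : int) u v, 0 <= m ->
  tnorm g (iterz f (n + m) x) (Dn f (n + m) x (P i x u)) *
    tnorm g (iterz f n x) (Dn f n x (P j x v)) <=
  C * expR (- (m%:~R * alpha)) *
    (tnorm g (iterz f n x) (Dn f n x (P i x u)) *
     tnorm g (iterz f (n + m) x) (Dn f (n + m) x (P j x v))).

Lemma dominated_mulP (E : 'I_k -> M -> {vspace 'rV[R]_d}) :
  dominated g f L E <-> exists C alpha : R, [/\ 1 < C, 0 < alpha &
    forall i j, (i < j)%N -> dominated_mul (oblique_proj E) C alpha i j].
Proof.
split=> -[C [alpha [C1 a0 h]]]; exists C, alpha; split => // i j ij.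
  move=> x Lx n m u v m0; have := h i j ij x Lx u v m n m0 => /=.
  have Dn_eq0 (n1 n2 : int) (w : 'rV[R]_d) :
      tnorm g (iterz f n1 x) (Dn f n1 x w) = 0 -> tnorm g (iterz f n2 x)
        (Dn f n2 x w) = 0.
    have [->|w0] := eqVneq w 0; first by rewrite !tnorm_Dn0.
    by move=> /eqP z; move: (tnorm_Dn_gt0 n1 x w0); rewrite lt_neqAle eq_sym z.
  apply: ler_of_ratio; [exact: tnorm_ge0|exact: tnorm_ge0|exact: Dn_eq0|exact:
    Dn_eq0].
move=> x Lx u v m n m0 /= den0; rewrite ler_pdivrMr; first exact: h.
by rewrite lt_neqAle eq_sym den0 mulr_ge0 ?tnorm_ge0.
Qed.

(* The link between i and j.+1 goes through a nonzero vector in the range of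
   P j. *)
Lemma dominated_mul_chain (P : 'I_k -> M -> 'End('rV[R]_d)) (K alpha : R) :
  1 < K -> 0 < alpha -> (forall j x, L x -> exists w, P j x w != 0) ->
  (forall i j, j = i.+1 :> nat -> dominated_mul P K alpha i j) ->
  forall i j, (i < j)%N -> dominated_mul P (K ^+ k) alpha i j.
Proof.
move=> K1 a0 nz h i j ij.
have K0 : 0 < K by exact: lt_trans K1.
suff H (l : nat) : forall j, (j = i + l.+1 :> nat)%N ->
  dominated_mul P (K ^+ l.+1) alpha i j.
  have ijl : (j = i + (j - i).-1.+1 :> nat)%N.
    by rewrite prednK ?subn_gt0// subnKC// ltnW.
  move=> x Lx n m u v m0; apply: (le_trans (H _ j ijl x Lx n m u v m0)).
  apply: ler_wpM2r; first by rewrite mulr_ge0 ?tnorm_ge0.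
  apply: ler_wpM2r; first exact: expR_ge0.
  by rewrite ler_weXn2l ?(ltW K1)// prednK ?subn_gt0// leq_subLR (leq_trans
    (ltnW (ltn_ord j)))// leq_addl.
elim: l => [|l IH] j' ij'; first by apply: h; rewrite ij' addn1.
have lt1 : (i + l.+1 < k)%N by have := ltn_ord j'; rewrite ij' addnS => /ltnW.
pose j1 := Ordinal lt1.
have h1 := IH j1 erefl.
have h2 : dominated_mul P K alpha j1 j' by apply: h; rewrite ij' addnS.
move=> x Lx n m u v m0.
have [w w0] := nz j1 x Lx.
have := h1 x Lx n m u w m0; have := h2 x Lx n m w v m0.
have := tnorm_Dn_gt0 n x w0; have := tnorm_Dn_gt0 (n + m) x w0.
(* Two links give two exponential factors. One is bounded by 1, so the rate remains [alpha] and only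
   the constant grows. *)
have : expR (- (m%:~R * alpha)) <= 1.
  by rewrite expR_le1 oppr_le0 mulr_ge0 ?ler0z// ltW.
have := expR_ge0 (- (m%:~R * alpha)).
move: (tnorm_ge0 g (iterz f (n + m) x) (Dn f (n + m) x (P i x u))).
move: (tnorm_ge0 g (iterz f n x) (Dn f n x (P j' x v))).
move: (tnorm_ge0 g (iterz f n x) (Dn f n x (P i x u))).
move: (tnorm_ge0 g (iterz f (n + m) x) (Dn f (n + m) x (P j' x v))).
move: (expR _) (tnorm _ _ (Dn f (n + m) x (P i x u)))
  (tnorm _ _ (Dn f n x (P j' x v)))
  (tnorm _ _ (Dn f n x (P i x u))) (tnorm _ _ (Dn f (n + m) x (P j' x v)))
  (tnorm _ _ (Dn f n x (P j1 x w))) (tnorm _ _ (Dn f (n + m) x (P j1 x w))).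
move=> q a b c e s t e0 c0 b0 a0' q0 q1 t0 s0 H2 H1.
have Kl : 0 <= K ^+ l.+1 by rewrite exprn_ge0 ?ltW.
have st : 0 < s * t by exact: mulr_gt0.
rewrite -(ler_pM2l st).
apply: le_trans (_ : _ <= (K ^+ l.+1 * q * (c * t)) * (K * q * (s * e))) _.
  have := ler_pM (mulr_ge0 a0' (ltW s0)) (mulr_ge0 (ltW t0) b0) H1 H2.
  by apply: le_trans; rewrite le_eqVlt; apply/orP; left; apply/eqP; ring.
have -> : (K ^+ l.+1 * q * (c * t)) * (K * q * (s * e)) =
   q * (s * t * (K ^+ l.+2 * q * (c * e))) by rewrite [K ^+ l.+2]exprS; ring.
by rewrite ler_piMl// !mulr_ge0 ?exprn_ge0 ?(ltW K0) ?(ltW s0) ?(ltW t0).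
Qed.

End Splittings.

Lemma cvg_expR_mulrn (R : realType) (C alpha : R) : 0 < alpha ->
  C * expR (- (m%:R * alpha)) @[m --> \oo] --> 0.
Proof.
move=> a0; rewrite -(mulr0 C); apply: cvgM; first exact: cvg_cst.
have -> : (fun m : nat => expR (- (m%:R * alpha))) = (fun m =>
  expR (- alpha) ^+ m).
  by apply/funext => m; rewrite -expRM_natl mulrN.
apply: cvg_expr; rewrite ger0_norm ?expR_ge0//.
by rewrite expR_lt1 oppr_lt0.
Qed.

(** * The two implications *)

Section Equivalence.
Variables (R : realType) (d : nat) (M : closed_manifold R d).
Variables (g : continuous_inner_product M) (f : diffeomorphism M) (L : set M).
Hypotheses (hLc : compact L) (hLf : f @` L = L).
Variables (k : nat) (dims : 'I_k -> nat).
Hypotheses (hdims : forall i, (1 <= dims i)%N).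

(** Domination is applied to u' = Df^{-n} u and v' = Df^{-(n+m)} v. By invariance Df^n P_i u' is
    P_i(f^n(x)) u, of norm at most B times that of u, and likewise for v' at time n + m; hence the
    factor B^2. *)
Lemma dominated_projectors (E : 'I_k -> M -> {vspace 'rV[R]_d}) :
  invariant_splitting f L E ->
  (forall i x, L x -> \dim (E i x) = dims i) -> dominated g f L E ->
  let P := oblique_proj E in
  [/\ forall i, projector L (P i), supplementary L P,
      forall i, projector_invariant f L (P i),
      forall i, projector_dim L (P i) (dims i) &
      exists K alpha : R, [/\ 1 < K, 0 < alpha &
        forall i j : 'I_k, (i < j)%N -> forall (m n : int) (x : M), 0 <= m ->
          L x ->
          opnorm g (iterz f n x) (iterz f (n + m) x)
            (Dn f (n + m) x \o P i x \o Dn f (- n) (iterz f n x))%VF *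
          opnorm g (iterz f (n + m) x) (iterz f n x)
            (Dn f n x \o P j x \o Dn f (- (n + m)) (iterz f (n + m) x))%VF
          <= K * expR (- (m%:~R * alpha))]].
Proof.
move=> spE dimE /dominated_mulP[C [alpha [C1 a0 dom]]] P.
have C0 : 0 < C by exact: lt_trans C1.
have supp : supplementary L P := oblique_proj_supplementary spE.
have inv i : projector_invariant f L (P i) := oblique_proj_invariant i hLf spE.
have dimP i : projector_dim L (P i) (dims i).
  by move=> x Lx; rewrite (limg_oblique_proj i spE Lx) dimE.
pose q (m : nat) := C * expR (- (m%:R * alpha)).
have q0 m : 0 <= q m by rewrite mulr_ge0 ?expR_ge0// ltW.
have qcvg : q @ \oo --> 0 := cvg_expR_mulrn C a0.
have domP (i j : 'I_k) : (i < j)%N -> forall x, L x -> forall (m : nat)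
  (u v : 'rV[R]_d),
    tnorm g (iterz f m x) (Dn f m x (P i x u)) * tnorm g x (P j x v) <=
    q m * (tnorm g x (P i x u) * tnorm g (iterz f m x) (Dn f m x (P j x v))).
  move=> ij x Lx m u v; have := dom i j ij x Lx 0 m u v isT.
  have E0 w : Dn f 0 x w = w.
    exact: (etrans (congr1 (fun h : 'End(_) => h w) (Dn0 f x)) (id_lfunE w)).
  have tr (a b c e b' c' z : R) : b = b' -> c = c' ->
    a * b' <= z * (c' * e) -> a * b <= z * (c * e) by move=> -> ->.
  exact: (tr _ _ _ _ _ _ _ (congr1 (tnorm g x) (esym (E0 _)))
    (congr1 (tnorm g x) (esym (E0 _)))).
have cont i : bundle_continuous L (P i).
  exact: (proj_bundle_continuous hLc hLf supp inv q0 qcvg domP dimP).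
have [B B0 hB] := projections_bounded hLc hLf supp q0 qcvg domP.
split => //.
  move=> i; split; first exact: cont.
  by move=> x Lx; apply/lfunP => u; rewrite comp_lfunE (supp_idem supp).
have BB0 : 0 <= C * (B * B) by rewrite !mulr_ge0// ltW.
(* Domination yields [C * (B * B)], which may be small; the added units make the constant exceed
   1. *)
exists (1 + C * (B * B) + 1), alpha; split => //.
  by rewrite -addrA ltrDl ltr_wpDl.
move=> i j ij m n x m0 Lx.
have e0 := expR_ge0 (- (m%:~R * alpha)).
apply: (@le_trans _ _ (C * (B * B) * expR (- (m%:~R * alpha)))); last first.
  apply: ler_wpM2r => //; lra.
apply: opnormM_le; first exact: mulr_ge0.
move=> u v; set u' := Dn f (- n) (iterz f n x) u.
set v' := Dn f (- (n + m)) (iterz f (n + m) x) v.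
have h1 : tnorm g (iterz f n x)
  (Dn f n x (P i x u')) <= B * tnorm g (iterz f n x) u.
  apply: (eq_ind_r (fun w => tnorm g _ w <= _) _ (Dn_proj hLf inv n i u' Lx)).
  apply: (eq_ind_r (fun w => tnorm g _ (P i _ w) <= _) _ (DnVK f n x u)).
  exact: hB (iterz_mem n hLf Lx) _ _.
have h2 : tnorm g (iterz f (n + m) x)
  (Dn f (n + m) x (P j x v')) <= B * tnorm g (iterz f (n + m) x) v.
  apply: (eq_ind_r (fun w =>
    tnorm g _ w <= _) _ (Dn_proj hLf inv (n + m) j v' Lx)).
  apply: (eq_ind_r (fun w => tnorm g _ (P j _ w) <= _) _ (DnVK f (n + m) x v)).
  exact: hB (iterz_mem (n + m) hLf Lx) _ _.
have h3 := dom i j ij x Lx n m u' v' m0.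
have c3 (A1 A2 A3 : 'End('rV[R]_d)) w : (A1 \o A2 \o A3)%VF w = A1 (A2 (A3 w)).
  by rewrite !comp_lfunE.
have tr (a b a' b' z : R) : a = a' -> b = b' -> a' * b' <= z -> a * b <= z
  by move=> -> ->.
apply: (tr _ _ _ _ _ (congr1 (tnorm g _) (c3 _ _ _ _)) (congr1 (tnorm g _)
  (c3 _ _ _ _))).
apply: (le_trans h3).
have := ler_pM (tnorm_ge0 _ _ _) (tnorm_ge0 _ _ _) h1 h2.
set tu := tnorm g (iterz f n x) u; set tv := tnorm g (iterz f (n + m) x) v.
move=> h4; have Ce : 0 <= C * expR (- (m%:~R * alpha))
  by rewrite mulr_ge0// ltW.
apply: le_trans (ler_wpM2l Ce h4) _.
by rewrite le_eqVlt; apply/orP; left; apply/eqP; ring.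
Qed.

(** The operator norms are tested on Df^n P_i u and Df^{n+m} P_j v: pulled back to x, these vectors
    lie in the ranges of the projectors, which fix them, so the norms in the definition of
    domination appear. *)
Lemma projectors_dominated_splitting (P : 'I_k -> M -> 'End('rV[R]_d))
  (K alpha : R) :
  (2 <= k)%N -> supplementary L P ->
    (forall i, projector_invariant f L (P i)) ->
  (forall i, projector_dim L (P i) (dims i)) -> 1 < K -> 0 < alpha ->
  (forall i j : 'I_k, j = i.+1 :> nat ->
    forall (m n : int) (x : M), 1 <= m -> L x ->
      opnorm g (iterz f n x) (iterz f (n + m) x)
        (Dn f (n + m) x \o P i x \o Dn f (- n) (iterz f n x))%VF *
      opnorm g (iterz f (n + m) x) (iterz f n x)
        (Dn f n x \o P j x \o Dn f (- (n + m)) (iterz f (n + m) x))%VF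
      <= K * expR (- (m%:~R * alpha))) ->
  admits_dominated_splitting g f L dims.
Proof.
move=> k2 supp inv dimP K1 a0 hop; pose E i x := limg (P i x).
have memE i x u : L x -> (u \in E i x) = (P i x u == u).
  move=> Lx; apply/idP/eqP => [/memv_imgP[w _ ->]|<-];
    first exact: (supp_idem supp).
  by rewrite memv_img ?memvf.
have spE : invariant_splitting f L E.
  move=> x Lx; split.
  - apply/directv_sum_independent => us usE us0 i _.
    have /eqP <- : P i x (us i) == us i by rewrite -memE// usE.
    have := congr1 (P i x) us0;
      rewrite linear0 linear_sum (bigD1 i)//= big1 ?addr0//.
    move=> j ji; have := usE j isT; rewrite memE// => /eqP <-.
    by rewrite (supp_orth supp)// eq_sym.
  - apply/eqP; rewrite eqEsubv subvf; apply/subvP => u _.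
    rewrite -(supp_sum supp u Lx); apply: memv_sumr => i _.
    by rewrite memv_img ?memvf.
  move=> i; have Lfx : L (f x) by rewrite -hLf; exists x.
  have fP u : tangent_map f x (P i x u) = P i (f x) (tangent_map f x u).
    by have := inv i x Lx => /lfunP/(_ u); rewrite !comp_lfunE.
  (* Invariance of the projector alone gives that Df maps E_i(x) into E_i(f(x)); surjectivity of Df
     makes it onto. *)
  have surj w : exists v, tangent_map f x v = w.
    by exists (Dn f (- 1) (iterz f 1 x) w); exact: (DnVK f 1 x w).
  move: fP surj; move: (tangent_map f x) => T fP surj.
  apply/eqP; rewrite eqEsubv; apply/andP; split; apply/subvP => w.
    by move=> /memv_imgP[v /memv_imgP[u _ ->] ->]; rewrite fP memv_img ?memvf.
  move=> /memv_imgP[v _ ->]; have [u <-] := surj v.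
  by rewrite -fP !memv_img ?memvf.
have oE i x : L x -> oblique_proj E i x = P i x.
  move=> Lx; apply/lfunP => u; rewrite -{1}(supp_sum supp u Lx).
  by apply: (oblique_proj_sum i spE Lx) => j; rewrite memv_img ?memvf.
exists E; split; [exact: spE|by move=> i x Lx; exact: dimP|].
apply/dominated_mulP; exists (K ^+ k), alpha; split => //.
  by rewrite exprn_egt1// -lt0n (leq_trans _ k2).
move=> i j ij.
(* Positive dimensions supply the intermediate vectors of the chain from i to j. *)
have nz l x : L x -> exists w, P l x w != 0.
  move=> Lx; apply: contrapT => nw; have := dimP l x Lx.
  rewrite (_ : limg (P l x) = 0%VS) ?dimv0.
    by move=> dl; have := hdims l; rewrite -dl.
  apply/eqP; rewrite -subv0; apply/subvP => w /memv_imgP[v _ ->].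
  rewrite memv0; apply/negPn/negP => v0; apply: nw; by exists v.
have step : forall i j : 'I_k, j = i.+1 :> nat ->
  dominated_mul g f L P K alpha i j.
  move=> {ij} {}i {}j ij x Lx n m u v.
  (* The operator bound starts at m = 1. At m = 0 the same norms stand on both sides and K > 1 is
     enough. *)
  move=> m0; have [->|m1] : m = 0 \/ 1 <= m.
      by case: m m0 => [[|m]|m] // _; [left|right].
    move: (n + 0) (addr0 n) => n' ->; rewrite mul0r oppr0 expR0 mulr1.
    by rewrite ler_peMl ?mulr_ge0 ?tnorm_ge0// ltW.
  have c3 (A1 A2 A3 : 'End('rV[R]_d)) w : (A1 \o A2 \o A3)%VF w = A1 (A2 (A3
    w)).
    by rewrite !comp_lfunE.
  have b n1 n2 l w : tnorm g (iterz f n2 x) (Dn f n2 x (P l x w)) <=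
      opnorm g (iterz f n1 x) (iterz f n2 x)
        (Dn f n2 x \o P l x \o Dn f (- n1) (iterz f n1 x))%VF *
      tnorm g (iterz f n1 x) (Dn f n1 x (P l x w)).
    have E1 : (Dn f n2 x \o P l x \o Dn f (- n1)
      (iterz f n1 x))%VF (Dn f n1 x (P l x w)) =
        Dn f n2 x (P l x w).
      apply: (etrans (c3 _ _ _ _));
        apply: (etrans (congr1 (fun v => Dn f n2 x (P l x v)) (DnK _ _ _ _))).
      exact: (congr1 (Dn f n2 x) (supp_idem supp _ _ Lx)).
    apply: (eq_ind _ (fun w' => tnorm g _ w' <= _) _ _ E1); exact: le_opnorm.
  have h1 := hop i j ij m n x m1 Lx.
  have := ler_pM (tnorm_ge0 _ _ _) (tnorm_ge0 _ _ _) (b n (n + m) i u)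
    (b (n + m) n j v).
  move/le_trans; apply; rewrite mulrACA; apply: ler_wpM2r => //.
  by rewrite mulr_ge0 ?tnorm_ge0.
have H := dominated_mul_chain K1 a0 nz step ij.
move=> x Lx; rewrite !oE//; exact: H.
Qed.

End Equivalence.

Theorem theorem2p2 (R : realType) (d : nat) (M : closed_manifold R d)
    (g : continuous_inner_product M) (f : diffeomorphism M) (L : set M)
    (hLc : compact L) (hLf : f @` L = L)
    (k : nat) (hk : (2 <= k)%N) (dims : 'I_k -> nat)
    (hdims : forall i, (1 <= dims i)%N) (hd : (\sum_i dims i)%N = d) :
  admits_dominated_splitting g f L dims <->
  exists P : 'I_k -> M -> 'End('rV[R]_d),
    [/\ forall i, projector L (P i),
        supplementary L P,
        forall i, projector_invariant f L (P i),
        forall i, projector_dim L (P i) (dims i) &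
        exists K alpha : R, [/\ 1 < K, 0 < alpha &
          forall i j : 'I_k, j = i.+1 :> nat ->
          forall (m n : int) (x : M), 1 <= m -> L x ->
            opnorm g (iterz f n x) (iterz f (n + m) x)
              (Dn f (n + m) x \o P i x \o Dn f (- n) (iterz f n x))%VF *
            opnorm g (iterz f (n + m) x) (iterz f n x)
              (Dn f n x \o P j x \o
                 Dn f (- (n + m)) (iterz f (n + m) x))%VF
            <= K * expR (- (m%:~R * alpha))]].
Proof.
split=> [[E [spE dimE domE]]|[P [_ supp inv dimP [K [alpha [K1 a0 h]]]]]];
  last first.
  exact: projectors_dominated_splitting h.
have [pr supp inv dimP [K [alpha [K1 a0 h]]]] :=
  dominated_projectors hLc hLf spE dimE domE.
exists (oblique_proj E); split => //; exists K, alpha; split => //.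
move=> i j ij m n x m1 Lx; apply: h => //; first by rewrite ij.
exact: le_trans m1.
Qed.
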